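(* Let $\Psi=\{\overline{\psi_\vartheta(-1)}\,\psi_\vartheta:\ \vartheta\in\widehat{\Theta}\}$. Then $H^\infty(\mathcal{K}_\Psi)=H^\infty_1(\mathbb{D})$ as sets, and $\|f\|_{H^\infty(\mathcal{K}_\Psi)}=\|f\|_{\infty}$ for every $f$ in this space.
   Context: $\widehat{\Theta}$ is the set of probability measures on the unit circle $\mathbb{T}$ of the following two kinds: (i) $\frac12(\delta_a+\delta_{-a})$ with $a\in\mathbb{T}$; (ii) $\lambda_1\delta_{w_1}+\lambda_2\delta_{w_2}+\lambda_3\delta_{w_3}$ with $w_1,w_2,w_3\in\mathbb{T}$ distinct, $0$ in the interior of the triangle with vertices $w_1,w_2,w_3$, and $(\lambda_1,\lambda_2,\lambda_3)$ the barycentric coordinates of $0$ with respect to these vertices. For $\vartheta\in\widehat\Theta$, $h_\vartheta(z)=\int_{\mathbb{T}}\frac{w+z}{w-z}\,d\vartheta(w)$ and $\psi_\vartheta=\frac{h_\vartheta-1}{h_\vartheta+1}$; $\psi_\vartheta$ is a Blaschke product of degree 2 or 3 with $\psi_\vartheta(0)=\psi_\vartheta'(0)=0$, so $|\psi_\vartheta(-1)|=1$ and $\Psi$ consists of such Blaschke products normalised to take the value $1$ at $-1$. $H^\infty_1(\mathbb{D})=\{g\in H^\infty(\mathbb{D}): g'(0)=0\}$ with the supremum norm. For a set $\Psi$ of functions on $\mathbb{D}$, $\mathcal{K}_\Psi$ is the set of positive semidefinite kernels $k:\mathbb{D}\times\mathbb{D}\to\mathbb{C}$ such that $(1-\psi(x)\overline{\psi(y)})k(x,y)$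 is a positive semidefinite kernel for every $\psi\in\Psi$. A function $f:\mathbb{D}\to\mathbb{C}$ lies in the closed unit ball of $H^\infty(\mathcal{K}_\Psi)$ iff $(1-f(x)\overline{f(y)})k(x,y)$ is positive semidefinite for every $k\in\mathcal{K}_\Psi$; $H^\infty(\mathcal{K}_\Psi)$ is the set of scalar multiples of such functions, with norm $\|f\|_{H^\infty(\mathcal{K}_\Psi)}=\inf\{t>0: f/t \text{ lies in this unit ball}\}$. *)

(* Defs.v *)
From Stdlib Require Import Reals Lra List.
Import ListNotations.
Open Scope R_scope.

Record Cx := mkC { Cre : R; Cim : R }.

Definition RtoC (r : R) : Cx := mkC r 0.
Definition C0 : Cx := RtoC 0.
Definition C1 : Cx := RtoC 1.
Definition Cadd (z w : Cx) : Cx := mkC (Cre z + Cre w) (Cim z + Cim w).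
Definition Copp (z : Cx) : Cx := mkC (- Cre z) (- Cim z).
Definition Csub (z w : Cx) : Cx := Cadd z (Copp w).
Definition Cmul (z w : Cx) : Cx :=
  mkC (Cre z * Cre w - Cim z * Cim w) (Cre z * Cim w + Cim z * Cre w).
Definition Cconj (z : Cx) : Cx := mkC (Cre z) (- Cim z).
Definition Cnorm2 (z : Cx) : R := Cre z * Cre z + Cim z * Cim z.
Definition Cnorm (z : Cx) : R := sqrt (Cnorm2 z).
(* inverse; the value at 0 is irrelevant (never used) *)
Definition Cinv (z : Cx) : Cx := mkC (Cre z / Cnorm2 z) (- Cim z / Cnorm2 z).
Definition Cdiv (z w : Cx) : Cx := Cmul z (Cinv w).

Fixpoint csum (n : nat) (f : nat -> Cx) : Cx :=
  match n with
  | O => C0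
  | S m => Cadd (csum m f) (f m)
  end.

Definition inD (z : Cx) : Prop := Cnorm z < 1.
Definition onT (z : Cx) : Prop := Cnorm z = 1.

Definition has_cderiv_at (f : Cx -> Cx) (z l : Cx) : Prop :=
  forall eps, 0 < eps -> exists delta, 0 < delta /\
    forall h, h <> C0 -> Cnorm h < delta -> inD (Cadd z h) ->
      Cnorm (Csub (Cdiv (Csub (f (Cadd z h)) (f z)) h) l) < eps.

Definition holomorphic_on_D (f : Cx -> Cx) : Prop :=
  forall z, inD z -> exists l, has_cderiv_at f z l.

Definition bounded_on_D (f : Cx -> Cx) : Prop :=
  exists M, forall z, inD z -> Cnorm (f z) <= M.

Definition in_Hinf1 (f : Cx -> Cx) : Prop :=
  holomorphic_on_D f /\ bounded_on_D f /\ has_cderiv_at f C0 C0.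

(** set of values |f z|, z in D; its least upper bound is the sup norm *)
Definition abs_values_on_D (f : Cx -> Cx) (r : R) : Prop :=
  exists z, inD z /\ r = Cnorm (f z).

Definition is_glb (E : R -> Prop) (m : R) : Prop :=
  (forall x, E x -> m <= x) /\ (forall b, (forall x, E x -> b <= x) -> b <= m).

Definition psd_kernel (k : Cx -> Cx -> Cx) : Prop :=
  forall (n : nat) (x : nat -> Cx) (c : nat -> Cx),
    (forall i, (i < n)%nat -> inD (x i)) ->
    let s := csum n (fun i => csum n (fun j =>
               Cmul (Cmul (c i) (Cconj (c j))) (k (x i) (x j)))) in
    Cim s = 0 /\ 0 <= Cre s.

Definition in_KPsi (Psi : (Cx -> Cx) -> Prop) (k : Cx -> Cx -> Cx) : Prop :=
  psd_kernel k /\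
  forall psi, Psi psi ->
    psd_kernel (fun x y => Cmul (Csub C1 (Cmul (psi x) (Cconj (psi y)))) (k x y)).

Definition in_ball_HinfK (Psi : (Cx -> Cx) -> Prop) (f : Cx -> Cx) : Prop :=
  forall k, in_KPsi Psi k ->
    psd_kernel (fun x y => Cmul (Csub C1 (Cmul (f x) (Cconj (f y)))) (k x y)).

Definition in_HinfK (Psi : (Cx -> Cx) -> Prop) (f : Cx -> Cx) : Prop :=
  exists (c : Cx) (g : Cx -> Cx), in_ball_HinfK Psi g /\
    forall z, inD z -> f z = Cmul c (g z).

(** the set { t > 0 : f / t lies in the unit ball }; the norm is its infimum *)
Definition norm_set_HinfK (Psi : (Cx -> Cx) -> Prop) (f : Cx -> Cx) (t : R) : Prop :=
  0 < t /\ in_ball_HinfK Psi (fun z => Cmul (RtoC (/ t)) (f z)).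

(** * The measures of Theta-hat, as lists of (weight, atom) *)
Definition Theta_hat (th : list (R * Cx)) : Prop :=
  (exists a, onT a /\ th = ((1/2)%R, a) :: ((1/2)%R, Copp a) :: nil)
  \/
  (exists (l1 l2 l3 : R) (w1 w2 w3 : Cx),
     th = (l1, w1) :: (l2, w2) :: (l3, w3) :: nil /\
     onT w1 /\ onT w2 /\ onT w3 /\ w1 <> w2 /\ w1 <> w3 /\ w2 <> w3 /\
     (* 0 in the interior of the triangle, (l1,l2,l3) its barycentric coords *)
     0 < l1 /\ 0 < l2 /\ 0 < l3 /\ l1 + l2 + l3 = 1 /\
     Cadd (Cadd (Cmul (RtoC l1) w1) (Cmul (RtoC l2) w2)) (Cmul (RtoC l3) w3) = C0).

(** h_theta(z) = \int (w+z)/(w-z) dtheta(w) *)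
Fixpoint h_theta (th : list (R * Cx)) (z : Cx) : Cx :=
  match th with
  | nil => C0
  | (l, w) :: rest =>
      Cadd (Cmul (RtoC l) (Cdiv (Cadd w z) (Csub w z))) (h_theta rest z)
  end.

Definition psi_theta (th : list (R * Cx)) (z : Cx) : Cx :=
  Cdiv (Csub (h_theta th z) C1) (Cadd (h_theta th z) C1).

(** psi_theta(-1): the boundary value of the Blaschke product psi_theta at -1,
    i.e. the radial limit of psi_theta(-r) as r -> 1^- *)
Definition boundary_value_at_m1 (f : Cx -> Cx) (c : Cx) : Prop :=
  forall eps, 0 < eps -> exists delta, 0 < delta /\
    forall r, 0 < r < 1 -> 1 - delta < r ->
      Cnorm (Csub (f (RtoC (- r))) c) < eps.

Definition Psi_hat (g : Cx -> Cx) : Prop :=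
  exists th c, Theta_hat th /\ boundary_value_at_m1 (psi_theta th) c /\
    g = (fun z => Cmul (Cconj c) (psi_theta th z)).

(* Main.v *)
From Coquelicot Require Import Hierarchy Continuity Derive RInt RInt_analysis AutoDerive.
From Coquelicot Require Import Rcomplements ElemFct SF_seq.
From Stdlib Require Import Reals Lra Lia List.
Require Import Defs.
Open Scope R_scope.

(** Multipliers of all the kernels lie in H^oo_1 because the kernel of
    {f in H^2 : f'(0) = 0} belongs to K_Psi: for psi = psi_theta,
    (1 - psi(x) psi(y)^* ) / (1 - x y^* ) is the Gram kernel of the functions
    v_w = 2 / ((w - x)(h_theta + 1)) for the measure theta, of which x is the
    mean against w^2.

    Conversely, let f in H^oo_1 satisfy |f| <= r < 1 and put h = (1 + f)/(1 - f),
    so that Re h > 0 and h'(0) = 0. By Cauchy's formula (h is only assumed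
    complex differentiable, hence Goursat's bisection) h(rho z) is the Herglotz
    integral of a positive density on the circle with vanishing first moment. The Riemann
    sums of that measure, balanced by one small atom, are positive combinations
    of elements of Theta-hat: a linear dependency between three atoms allows one
    to remove an atom. Hence (h(rho x) + h(rho y)^* ) k(x, y) is positive
    for every k in K_Psi; let rho tend to 1. *)

(* The kernels [k] are arbitrary functions, without continuity in any variable. So everything
   happens in one finite form at fixed points and coefficients, and the only variable ever
   integrated is the atom [w] on the circle. The Cayley transform makes this possible:
   [1 - psi psi^*] is not linear in the measure, whereas [h + h^*] is, so positivity on [Theta_hat]
   passes to positive combinations. The condition h'(0) = 0 is the vanishing of the first moment,
   and the two kinds in [Theta_hat] are the extreme points of the probability measures with that
   property. Choquet's theorem is avoided: only finitely supported measures are decomposed, as the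
   integral enters through Riemann sums. In the other direction a multiplier is a bare function. Its
   bound, its derivative at 0 and its holomorphy are read off from forms at one, two and three
   points for a single kernel. Only real functions are integrated; a complex identity is stated as
   an identity of real parts after multiplication by an arbitrary constant. *)
Declare Scope cx_scope.
Delimit Scope cx_scope with cx.
Bind Scope cx_scope with Cx.
Notation "x + y" := (Cadd x y) : cx_scope.
Notation "x - y" := (Csub x y) : cx_scope.
Notation "- x" := (Copp x) : cx_scope.
Notation "x * y" := (Cmul x y) : cx_scope.
Notation "x / y" := (Cdiv x y) : cx_scope.
Notation "x ^*" := (Cconj x) (at level 2, format "x ^*") : cx_scope.
Notation "1" := C1 : cx_scope.
Notation "0" := C0 : cx_scope.
Arguments Cnorm z%_cx.
Arguments Cnorm2 z%_cx.
Arguments Cre _%_cx.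
Arguments Cim _%_cx.
Arguments Cadd (z w)%_cx.
Arguments Csub (z w)%_cx.
Arguments Cmul (z w)%_cx.
Arguments Cdiv (z w)%_cx.
Arguments Cinv z%_cx.
Arguments Cconj z%_cx.
Arguments Copp z%_cx.

Definition Ci : Cx := mkC 0 1.

(** * Complex arithmetic *)

Lemma Cx_eq (z w : Cx) : Cre z = Cre w -> Cim z = Cim w -> z = w.
Proof. destruct z, w; simpl; intros; subst; reflexivity. Qed.

Lemma Cx_eq_dec (z w : Cx) : {z = w} + {z <> w}.
Proof.
destruct z as [a b], w as [c d].
destruct (Req_EM_T a c); [destruct (Req_EM_T b d)|]; [left|right|right]; congruence.
Qed.

Ltac cx_unfold :=
  unfold Cdiv, Csub, Cmul, Cadd, Copp, Cconj, C1, C0, RtoC, Ci in *; simpl in *.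
Ltac cx_ring := apply Cx_eq; cx_unfold; ring.

Lemma Cnorm2_eq0 (z : Cx) : Cnorm2 z = 0 -> z = C0.
Proof.
unfold Cnorm2; intros H; apply Cx_eq; cx_unfold; nra.
Qed.

Lemma Cnorm2_ge0 (z : Cx) : 0 <= Cnorm2 z.
Proof. unfold Cnorm2; nra. Qed.

Lemma Cnorm2_gt0 (z : Cx) : z <> C0 -> 0 < Cnorm2 z.
Proof.
intros H; destruct (Cnorm2_ge0 z) as [E|E]; auto.
elim H; apply Cnorm2_eq0; auto.
Qed.

Lemma Cx_field_theory : field_theory C0 C1 Cadd Cmul Csub Copp Cdiv Cinv eq.
Proof.
constructor.
- constructor; intros; try reflexivity; cx_ring.
- intros H; apply (f_equal Cre) in H; cx_unfold; lra.
- reflexivity.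
- intros z Hz; apply Cnorm2_gt0 in Hz.
  apply Cx_eq; unfold Cmul, Cinv, C1, RtoC, Cnorm2 in *; simpl; field; lra.
Qed.
Add Field Cx_field : Cx_field_theory.

Lemma Cnorm_ge0 (z : Cx) : 0 <= Cnorm z.
Proof. apply sqrt_pos. Qed.

Lemma Cnorm_sqr (z : Cx) : Cnorm z * Cnorm z = Cnorm2 z.
Proof. apply sqrt_sqrt, Cnorm2_ge0. Qed.

Lemma Cnorm_sqr_conj (z : Cx) : (z * z^*)%cx = RtoC (Cnorm z * Cnorm z).
Proof. rewrite Cnorm_sqr; unfold Cnorm2; cx_ring. Qed.

Lemma Cnorm_le_of_sqr (z : Cx) (r : R) : 0 <= r -> Cnorm2 z <= r * r -> Cnorm z <= r.
Proof.
intros Hr H; rewrite <- Cnorm_sqr in H; generalize (Cnorm_ge0 z); nra.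
Qed.

Lemma Cnorm_mul (z w : Cx) : Cnorm (z * w) = Cnorm z * Cnorm w.
Proof.
unfold Cnorm; rewrite <- sqrt_mult by apply Cnorm2_ge0.
f_equal; unfold Cnorm2; cx_unfold; ring.
Qed.

Lemma Cnorm_RtoC (r : R) : Cnorm (RtoC r) = Rabs r.
Proof.
unfold Cnorm, Cnorm2, RtoC; simpl.
replace (r * r + 0 * 0) with (Rsqr r) by (unfold Rsqr; ring).
apply sqrt_Rsqr_abs.
Qed.

Lemma Cnorm0 : Cnorm C0 = 0.
Proof. unfold C0; rewrite Cnorm_RtoC; apply Rabs_R0. Qed.

Lemma Cnorm1 : Cnorm C1 = 1.
Proof. unfold C1; rewrite Cnorm_RtoC; apply Rabs_R1. Qed.

Lemma Cnorm_opp (z : Cx) : Cnorm (- z) = Cnorm z.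
Proof. unfold Cnorm; f_equal; unfold Cnorm2; cx_unfold; ring. Qed.

Lemma Cnorm_conj (z : Cx) : Cnorm z^* = Cnorm z.
Proof. unfold Cnorm; f_equal; unfold Cnorm2; cx_unfold; ring. Qed.

Lemma Cre_le_norm (z : Cx) : Rabs (Cre z) <= Cnorm z.
Proof.
generalize (Cnorm_sqr z) (Cnorm_ge0 z); unfold Cnorm2; intros.
apply Rabs_le; split; nra.
Qed.

Lemma Cim_le_norm (z : Cx) : Rabs (Cim z) <= Cnorm z.
Proof.
generalize (Cnorm_sqr z) (Cnorm_ge0 z); unfold Cnorm2; intros.
apply Rabs_le; split; nra.
Qed.

Lemma Cnorm_le_re_im (z : Cx) : Cnorm z <= Rabs (Cre z) + Rabs (Cim z).
Proof.
generalize (Rabs_pos (Cre z)) (Rabs_pos (Cim z)); intros.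
apply Cnorm_le_of_sqr; [lra|]; unfold Cnorm2.
assert (E : forall x, x * x = Rabs x * Rabs x).
{ intros x; rewrite <- Rabs_mult; symmetry; apply Rabs_pos_eq; nra. }
rewrite (E (Cre z)), (E (Cim z)); nra.
Qed.

Lemma Cnorm_triangle (z w : Cx) : Cnorm (z + w) <= Cnorm z + Cnorm w.
Proof.
generalize (Cnorm_ge0 z) (Cnorm_ge0 w); intros.
apply Cnorm_le_of_sqr; [lra|].
assert (E : Cnorm2 (z + w) = Cnorm2 z + Cnorm2 w + 2 * Cre (z * w^*)).
{ unfold Cnorm2; cx_unfold; ring. }
generalize (Cre_le_norm (z * w^*)); rewrite Cnorm_mul, Cnorm_conj.
intros H1; apply Rabs_le_between in H1.
rewrite E, <- !Cnorm_sqr; nra.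
Qed.

Lemma Cnorm_sub_triangle (z w : Cx) : Cnorm (z - w) <= Cnorm z + Cnorm w.
Proof. unfold Csub; rewrite <- (Cnorm_opp w); apply Cnorm_triangle. Qed.

Lemma Cnorm_sub_ge (z w : Cx) : Cnorm z - Cnorm w <= Cnorm (z - w).
Proof.
generalize (Cnorm_triangle (z - w) w).
replace (z - w + w)%cx with z by ring; lra.
Qed.

Lemma Cnorm_sub_sym (z w : Cx) : Cnorm (z - w) = Cnorm (w - z).
Proof. rewrite <- Cnorm_opp; f_equal; ring. Qed.

Lemma Cnorm_eq0 (z : Cx) : Cnorm z = 0 -> z = C0.
Proof. intros H; apply Cnorm2_eq0; rewrite <- Cnorm_sqr, H; ring. Qed.

Lemma Cnorm_gt0 (z : Cx) : z <> C0 -> 0 < Cnorm z.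
Proof.
intros H; destruct (Cnorm_ge0 z) as [E|E]; auto.
elim H; apply Cnorm_eq0; auto.
Qed.

Lemma Cneq0_of_norm (z : Cx) : 0 < Cnorm z -> z <> C0.
Proof. intros H ->; rewrite Cnorm0 in H; lra. Qed.

Lemma Csub_neq0 (z w : Cx) : z <> w -> (z - w)%cx <> C0.
Proof.
intros H E; apply H.
replace z with (z - w + w)%cx by ring; rewrite E; ring.
Qed.

Lemma Cnorm_inv (z : Cx) : z <> C0 -> Cnorm (Cinv z) = / Cnorm z.
Proof.
intros H; generalize (Cnorm_gt0 _ H); intros Hp.
apply Rmult_eq_reg_l with (Cnorm z); [|lra].
rewrite <- Cnorm_mul, Rinv_r by lra.
replace (z * Cinv z)%cx with C1 by (field; auto); apply Cnorm1.
Qed.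

Lemma Cnorm_div (z w : Cx) : w <> C0 -> Cnorm (z / w) = Cnorm z / Cnorm w.
Proof. intros H; unfold Cdiv; rewrite Cnorm_mul, Cnorm_inv; auto. Qed.

Lemma Cconj_add (z w : Cx) : (z + w)^*%cx = (z^* + w^*)%cx.
Proof. cx_ring. Qed.
Lemma Cconj_sub (z w : Cx) : (z - w)^*%cx = (z^* - w^*)%cx.
Proof. cx_ring. Qed.
Lemma Cconj_opp (z : Cx) : (- z)^*%cx = (- z^*)%cx.
Proof. cx_ring. Qed.
Lemma Cconj_mul (z w : Cx) : (z * w)^*%cx = (z^* * w^*)%cx.
Proof. cx_ring. Qed.
Lemma Cconj_invol (z : Cx) : z^*^*%cx = z.
Proof. cx_ring. Qed.
Lemma Cconj_inv (z : Cx) : (Cinv z)^*%cx = Cinv z^*.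
Proof.
assert (E : Cnorm2 z^* = Cnorm2 z) by (unfold Cnorm2; cx_unfold; ring).
unfold Cinv; rewrite E; apply Cx_eq; cx_unfold; unfold Rdiv; ring.
Qed.
Lemma Cconj_div (z w : Cx) : (z / w)^*%cx = (z^* / w^*)%cx.
Proof. unfold Cdiv; rewrite Cconj_mul, Cconj_inv; reflexivity. Qed.
Lemma Cconj_RtoC (r : R) : (RtoC r)^*%cx = RtoC r.
Proof. cx_ring. Qed.
Lemma Cconj_1 : 1^*%cx = 1%cx.
Proof. apply Cconj_RtoC. Qed.
Lemma Cconj_0 : 0^*%cx = 0%cx.
Proof. apply Cconj_RtoC. Qed.
Lemma Cconj_neq0 (z : Cx) : z <> C0 -> (z^*)%cx <> C0.
Proof.
intros H E; apply H; rewrite <- (Cconj_invol z), E; apply Cconj_0.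
Qed.
Hint Rewrite Cconj_add Cconj_sub Cconj_opp Cconj_mul Cconj_inv Cconj_div
  Cconj_RtoC Cconj_1 Cconj_0 Cconj_invol : cconj.

Lemma RtoC_mul (a b : R) : RtoC (a * b) = (RtoC a * RtoC b)%cx.
Proof. cx_ring. Qed.
Lemma RtoC_neq0 (r : R) : r <> 0 -> RtoC r <> C0.
Proof. intros H E; apply H; apply (f_equal Cre) in E; exact E. Qed.
Lemma Cre_add (z w : Cx) : Cre (z + w) = Cre z + Cre w.
Proof. reflexivity. Qed.
Lemma Cre_scal (r : R) (z : Cx) : Cre (RtoC r * z) = r * Cre z.
Proof. cx_unfold; ring. Qed.

Lemma onT_conj_mul (w : Cx) : onT w -> (w * w^*)%cx = C1.
Proof. unfold onT; intros H; rewrite Cnorm_sqr_conj, H; cx_ring. Qed.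

Lemma onT_neq0 (w : Cx) : onT w -> w <> C0.
Proof. unfold onT; intros H; apply Cneq0_of_norm; lra. Qed.

Lemma onT_conj_inv (w : Cx) : onT w -> (w^*)%cx = Cinv w.
Proof.
intros H; generalize (onT_neq0 _ H); intros H0.
replace (Cinv w) with (Cinv w * (w * w^*))%cx by (rewrite onT_conj_mul by auto; ring).
field; auto.
Qed.

Lemma onT_sub_neq0 (w z : Cx) : onT w -> inD z -> (w - z)%cx <> C0.
Proof.
unfold onT, inD; intros H1 H2; apply Cneq0_of_norm.
generalize (Cnorm_sub_ge w z); lra.
Qed.

Lemma one_sub_mul_conj_neq0 (x y : Cx) : Cnorm x < 1 -> Cnorm y <= 1 -> (1 - x * y^*)%cx <> C0.
Proof.
intros Hx Hy; apply Cneq0_of_norm.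
generalize (Cnorm_sub_ge 1 (x * y^*)).
rewrite Cnorm1, Cnorm_mul, Cnorm_conj.
generalize (Cnorm_ge0 x) (Cnorm_ge0 y); nra.
Qed.

(** * Limits, continuity and complex derivatives *)

(** Stated for an arbitrary filter, so that the same rules serve neighbourhoods, punctured
    neighbourhoods, products of them, sequences and limits from the left at 1. *)
Definition clim {T : Type} (F : (T -> Prop) -> Prop) (g : T -> Cx) (l : Cx) : Prop :=
  forall eps, 0 < eps -> F (fun t => Cnorm (g t - l) < eps).

Definition near (z : Cx) (P : Cx -> Prop) : Prop :=
  exists d, 0 < d /\ forall w, Cnorm (w - z) < d -> P w.

Definition ccont (f : Cx -> Cx) (z : Cx) : Prop := clim (near z) f (f z).

Global Instance near_filter (z : Cx) : Filter (near z).
Proof.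
constructor.
- exists 1; split; [lra|auto].
- intros P Q [d [Hd HP]] [e [He HQ]]; exists (Rmin d e); split.
  + apply Rmin_pos; auto.
  + intros w Hw; generalize (Rmin_l d e) (Rmin_r d e); intros.
    split; [apply HP | apply HQ]; lra.
- intros P Q H [d [Hd HP]]; exists d; split; auto.
Qed.

Lemma near_neq (z a : Cx) : z <> a -> near z (fun w => w <> a).
Proof.
intros H; apply Csub_neq0, Cnorm_gt0 in H.
exists (Cnorm (z - a)); split; auto.
intros w Hw ->; rewrite Cnorm_sub_sym in Hw; lra.
Qed.

Section Clim.
Context {T : Type} {F : (T -> Prop) -> Prop} {FF : Filter F}.

Lemma clim_re_im (g : T -> Cx) (l : Cx) :
  clim F g l <-> filterlim (fun t => Cre (g t)) F (locally (Cre l)) /\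
                 filterlim (fun t => Cim (g t)) F (locally (Cim l)).
Proof.
split.
- intros H; split; apply filterlim_locally; intros eps;
    generalize (H eps (cond_pos eps)); apply filter_imp; intros t Ht;
    (eapply Rle_lt_trans; [|exact Ht]).
  + apply (Cre_le_norm (g t - l)).
  + apply (Cim_le_norm (g t - l)).
- intros [H1 H2] eps Heps.
  assert (He : 0 < eps / 2) by lra.
  generalize (proj1 (filterlim_locally _ _) H1 (mkposreal _ He)).
  generalize (proj1 (filterlim_locally _ _) H2 (mkposreal _ He)).
  intros K2 K1; generalize (filter_and _ _ K1 K2); apply filter_imp.
  intros t [L1 L2].
  eapply Rle_lt_trans; [apply Cnorm_le_re_im|].
  replace eps with (eps / 2 + eps / 2) by field.
  apply Rplus_lt_compat; [apply L1 | apply L2].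
Qed.

Lemma clim_const (c : Cx) : clim F (fun _ => c) c.
Proof.
intros eps He; apply filter_forall; intros _.
replace (c - c)%cx with C0 by ring; rewrite Cnorm0; auto.
Qed.

Lemma clim_ext_loc (f g : T -> Cx) (l : Cx) :
  F (fun t => f t = g t) -> clim F f l -> clim F g l.
Proof.
intros E H eps He; generalize (filter_and _ _ E (H eps He)).
apply filter_imp; intros t [<- Ht]; auto.
Qed.

Lemma clim_add (f g : T -> Cx) (a b : Cx) :
  clim F f a -> clim F g b -> clim F (fun t => f t + g t)%cx (a + b).
Proof.
rewrite !clim_re_im; intros [A1 A2] [B1 B2]; split.
- eapply filterlim_comp_2; [exact A1|exact B1|exact (filterlim_plus (Cre a) (Cre b))].
- eapply filterlim_comp_2; [exact A2|exact B2|exact (filterlim_plus (Cim a) (Cim b))].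
Qed.

Lemma clim_mul (f g : T -> Cx) (a b : Cx) :
  clim F f a -> clim F g b -> clim F (fun t => f t * g t)%cx (a * b).
Proof.
rewrite !clim_re_im; intros [A1 A2] [B1 B2].
assert (M : forall (u v : T -> R) (c d : R), filterlim u F (locally c) ->
  filterlim v F (locally d) -> filterlim (fun t => u t * v t) F (locally (c * d))).
{ intros u v c d U V.
  eapply filterlim_comp_2; [exact U|exact V|exact (filterlim_mult (K := R_AbsRing) c d)]. }
split.
- change (filterlim (fun t => Cre (f t) * Cre (g t) + - (Cim (f t) * Cim (g t))) F
    (locally (Cre a * Cre b + - (Cim a * Cim b)))).
  eapply filterlim_comp_2; [exact (M _ _ _ _ A1 B1)| |exact (filterlim_plus _ _)].
  eapply filterlim_comp; [exact (M _ _ _ _ A2 B2)|].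
  exact (filterlim_opp (Cim a * Cim b)).
- eapply filterlim_comp_2; [exact (M _ _ _ _ A1 B2)|exact (M _ _ _ _ A2 B1)|].
  exact (filterlim_plus (Cre a * Cim b) (Cim a * Cre b)).
Qed.

Lemma clim_opp (f : T -> Cx) (a : Cx) : clim F f a -> clim F (fun t => - f t)%cx (- a).
Proof.
intros H eps He; generalize (H eps He); apply filter_imp; intros t Ht.
replace (- f t - - a)%cx with (- (f t - a))%cx by ring; rewrite Cnorm_opp; auto.
Qed.

Lemma clim_sub (f g : T -> Cx) (a b : Cx) :
  clim F f a -> clim F g b -> clim F (fun t => f t - g t)%cx (a - b).
Proof. intros A B; apply clim_add, clim_opp; auto. Qed.

Lemma clim_conj (f : T -> Cx) (a : Cx) : clim F f a -> clim F (fun t => (f t)^*)%cx (a^*)%cx.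
Proof.
intros H eps He; generalize (H eps He); apply filter_imp; intros t Ht.
rewrite <- Cconj_sub, Cnorm_conj; auto.
Qed.

Lemma clim_inv (f : T -> Cx) (a : Cx) : a <> C0 -> clim F f a -> clim F (fun t => Cinv (f t)) (Cinv a).
Proof.
intros Ha H.
set (m := Cnorm a); assert (Hm : 0 < m) by (apply Cnorm_gt0; auto).
intros eps He.
(* The first bound keeps the modulus of [f t] above [m / 2]; the second then controls the quotient
   of [a - f t] by [f t * a], whose denominator exceeds [m * m / 2] in modulus. *)
assert (He' : 0 < Rmin (m / 2) (eps * (m * m / 2))).
{ apply Rmin_pos; [lra|]; repeat apply Rmult_lt_0_compat; lra. }
generalize (H _ He'); apply filter_imp; intros t Ht.
generalize (Rmin_l (m / 2) (eps * (m * m / 2))) (Rmin_r (m / 2) (eps * (m * m / 2))); intros M1 M2.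
assert (Hft : m / 2 < Cnorm (f t)).
{ generalize (Cnorm_sub_ge a (a - f t)).
  replace (a - (a - f t))%cx with (f t) by ring.
  rewrite (Cnorm_sub_sym a); fold m; lra. }
assert (Hf0 : f t <> C0) by (apply Cneq0_of_norm; lra).
replace (Cinv (f t) - Cinv a)%cx with ((a - f t) / (f t * a))%cx by (field; auto).
rewrite Cnorm_div, Cnorm_mul, Cnorm_sub_sym.
2: { apply Cneq0_of_norm; rewrite Cnorm_mul; fold m; nra. }
fold m; apply Rmult_lt_reg_r with (Cnorm (f t) * m); [nra|].
unfold Rdiv; rewrite Rmult_assoc, Rinv_l by nra.
rewrite Rmult_1_r; eapply Rlt_le_trans; [apply Ht|].
eapply Rle_trans; [apply M2|]; apply Rmult_le_compat_l; nra.
Qed.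

Lemma clim_div (f g : T -> Cx) (a b : Cx) : b <> C0 ->
  clim F f a -> clim F g b -> clim F (fun t => f t / g t)%cx (a / b).
Proof. intros Hb A B; apply clim_mul, clim_inv; auto. Qed.

Lemma clim_comp (f : Cx -> Cx) (g : T -> Cx) (l : Cx) :
  ccont f l -> clim F g l -> clim F (fun t => f (g t)) (f l).
Proof.
intros Hf Hg eps He; destruct (Hf eps He) as [d [Hd H]].
generalize (Hg d Hd); apply filter_imp; auto.
Qed.

End Clim.

Lemma ccont_id (z : Cx) : ccont (fun w => w) z.
Proof. intros eps He; exists eps; auto. Qed.

Lemma ccont_comp (f g : Cx -> Cx) (z : Cx) :
  ccont f (g z) -> ccont g z -> ccont (fun w => f (g w)) z.
Proof. intros Hf Hg; exact (clim_comp _ _ _ Hf Hg). Qed.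

(* Caratheodory's form of the derivative: all the rules become algebra on continuous difference quotients. *)
Definition cdiff (f : Cx -> Cx) (z l : Cx) : Prop :=
  exists q, ccont q z /\ q z = l /\ near z (fun w => (f w - f z = q w * (w - z))%cx).

Lemma cdiff_cont (f : Cx -> Cx) (z l : Cx) : cdiff f z l -> ccont f z.
Proof.
intros [q [Hq [_ E]]]; unfold ccont.
replace (f z) with (f z + q z * (z - z))%cx by ring.
apply clim_ext_loc with (fun w => f z + q w * (w - z))%cx.
- revert E; apply filter_imp; intros w <-; ring.
- apply clim_add; [apply clim_const|]; apply clim_mul; auto.
  apply clim_sub; [apply ccont_id|apply clim_const].
Qed.

Lemma cdiff_const (c z : Cx) : cdiff (fun _ => c) z C0.
Proof.
exists (fun _ => C0); split; [apply clim_const|split; auto].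
apply filter_forall; intros; ring.
Qed.

Lemma cdiff_id (z : Cx) : cdiff (fun w => w) z C1.
Proof.
exists (fun _ => C1); split; [apply clim_const|split; auto].
apply filter_forall; intros; ring.
Qed.

Lemma cdiff_add (f g : Cx -> Cx) (z a b : Cx) :
  cdiff f z a -> cdiff g z b -> cdiff (fun w => f w + g w)%cx z (a + b).
Proof.
intros [p [Hp [<- Ef]]] [q [Hq [<- Eg]]].
exists (fun w => p w + q w)%cx; split; [apply clim_add; auto|split; auto].
generalize (filter_and _ _ Ef Eg); apply filter_imp; intros w [E1 E2].
replace (f w + g w - (f z + g z))%cx with ((f w - f z) + (g w - g z))%cx by ring.
rewrite E1, E2; ring.
Qed.

Lemma cdiff_opp (f : Cx -> Cx) (z a : Cx) : cdiff f z a -> cdiff (fun w => - f w)%cx z (- a).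
Proof.
intros [p [Hp [<- E]]].
exists (fun w => - p w)%cx; split; [apply clim_opp; auto|split; auto].
revert E; apply filter_imp; intros w E.
replace (- f w - - f z)%cx with (- (f w - f z))%cx by ring; rewrite E; ring.
Qed.

Lemma cdiff_sub (f g : Cx -> Cx) (z a b : Cx) :
  cdiff f z a -> cdiff g z b -> cdiff (fun w => f w - g w)%cx z (a - b).
Proof. intros A B; apply cdiff_add, cdiff_opp; auto. Qed.

Lemma cdiff_mul (f g : Cx -> Cx) (z a b : Cx) :
  cdiff f z a -> cdiff g z b -> cdiff (fun w => f w * g w)%cx z (a * g z + f z * b).
Proof.
intros Df Dg; generalize (cdiff_cont _ _ _ Dg); intros Cg.
destruct Df as [p [Hp [<- Ef]]]; destruct Dg as [q [Hq [<- Eg]]].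
exists (fun w => p w * g w + f z * q w)%cx; split; [|split; auto].
- apply clim_add; apply clim_mul; auto; apply clim_const.
- generalize (filter_and _ _ Ef Eg); apply filter_imp; intros w [E1 E2].
  replace (f w * g w - f z * g z)%cx with ((f w - f z) * g w + f z * (g w - g z))%cx by ring.
  rewrite E1, E2; ring.
Qed.

Lemma cdiff_inv (g : Cx -> Cx) (z b : Cx) : g z <> C0 ->
  cdiff g z b -> cdiff (fun w => Cinv (g w)) z (- b / (g z * g z)).
Proof.
intros H0 Dg; generalize (cdiff_cont _ _ _ Dg); intros Cg.
destruct Dg as [q [Hq [<- Eg]]].
exists (fun w => - q w / (g w * g z))%cx; split; [|split; auto].
- apply clim_div; [|apply clim_opp; auto|apply clim_mul; auto; apply clim_const].
  apply Cneq0_of_norm; rewrite Cnorm_mul.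
  generalize (Cnorm_gt0 _ H0); nra.
- destruct (near_neq _ _ H0) as [d [Hd N]].
  generalize (filter_and _ _ Eg (Cg d Hd)); apply filter_imp; intros w [E N'].
  assert (g w <> C0) by (apply N; auto).
  replace (Cinv (g w) - Cinv (g z))%cx with (- (g w - g z) / (g w * g z))%cx by (field; auto).
  rewrite E; field; auto.
Qed.

Lemma cdiff_div (f g : Cx -> Cx) (z a b : Cx) : g z <> C0 ->
  cdiff f z a -> cdiff g z b ->
  cdiff (fun w => f w / g w)%cx z (a * Cinv (g z) + f z * (- b / (g z * g z))).
Proof.
intros H0 A B; exact (cdiff_mul f (fun w => Cinv (g w)) z _ _ A (cdiff_inv g z b H0 B)).
Qed.

Lemma cdiff_scaled (f : Cx -> Cx) (r z l : Cx) :
  cdiff f (r * z) l -> cdiff (fun w => f (r * w)%cx) z (l * r).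
Proof.
intros [q [Hq [<- E]]].
assert (C : ccont (fun w => r * w)%cx z) by (apply clim_mul; [apply clim_const|apply ccont_id]).
exists (fun w => q (r * w) * r)%cx; split; [|split; auto].
- apply clim_mul; [|apply clim_const]; exact (ccont_comp _ _ _ Hq C).
- destruct E as [d [Hd E]]; generalize (C d Hd); apply filter_imp; intros w Hw.
  rewrite E by auto; ring.
Qed.

Lemma near_inD (z : Cx) : inD z -> near z inD.
Proof.
unfold inD; intros Hz; exists (1 - Cnorm z); split; [lra|]; intros w Hw.
generalize (Cnorm_triangle (w - z) z).
replace (w - z + z)%cx with w by ring; lra.
Qed.

(** [has_cderiv_at] tests only increments that stay in the disc; since the disc is open, this is no
    restriction near [z]. The quotient is completed by the value [l] at [z]. *)
Lemma has_cderiv_at_cdiff (f : Cx -> Cx) (z l : Cx) :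
  inD z -> has_cderiv_at f z l -> cdiff f z l.
Proof.
intros Hz H.
exists (fun w => if Cx_eq_dec w z then l else ((f w - f z) / (w - z))%cx); split; [|split].
- intros eps He; destruct (H eps He) as [d [Hd K]].
  destruct (Cx_eq_dec z z) as [_|N]; [|elim N; auto].
  destruct (near_inD _ Hz) as [e [He' N]].
  exists (Rmin d e); split; [apply Rmin_pos; auto|]; intros w Hw.
  generalize (Rmin_l d e) (Rmin_r d e); intros M1 M2.
  destruct (Cx_eq_dec w z) as [->|Hwz].
  + replace (l - l)%cx with C0 by ring; rewrite Cnorm0; auto.
  + generalize (K (w - z)%cx); replace (z + (w - z))%cx with w by ring.
    intros K'; apply K'; [apply Csub_neq0; auto|lra|apply N; lra].
- destruct (Cx_eq_dec z z) as [_|N]; [auto|elim N; auto].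
- apply filter_forall; intros w; destruct (Cx_eq_dec w z) as [->|N]; [ring|].
  field; apply Csub_neq0; auto.
Qed.

Lemma cdiff_has_cderiv_at (f : Cx -> Cx) (z l : Cx) :
  cdiff f z l -> has_cderiv_at f z l.
Proof.
intros [q [Hq [<- E]]] eps He.
destruct (filter_and _ _ E (Hq eps He)) as [d [Hd K]].
exists d; split; auto; intros h Hh Hhd _.
destruct (K (z + h)%cx) as [K1 K2].
{ replace (z + h - z)%cx with h by ring; auto. }
rewrite K1; replace (q (z + h) * (z + h - z) / h)%cx with (q (z + h)%cx) by (field; auto).
auto.
Qed.

Lemma has_cderiv_at_ext (f g : Cx -> Cx) (z l : Cx) : inD z ->
  (forall w, inD w -> f w = g w) -> has_cderiv_at f z l -> has_cderiv_at g z l.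
Proof.
intros Hz E H eps He; destruct (H eps He) as [d [Hd K]].
exists d; split; auto; intros h H0 Hh Hin.
rewrite <- !E; auto.
Qed.

(** * Goursat's lemma and Cauchy's formula *)

Lemma nested_intervals (u v : nat -> R) :
  (forall n, u n <= u (S n)) -> (forall n, v (S n) <= v n) -> (forall n, u n <= v n) ->
  exists s, forall n, u n <= s <= v n.
Proof.
intros Hu Hv Huv.
assert (U : forall n m, u n <= u (n + m)%nat).
{ intros n m; induction m; [rewrite Nat.add_0_r; lra|].
  rewrite Nat.add_succ_r; eapply Rle_trans; [exact IHm|apply Hu]. }
assert (V : forall n m, v (n + m)%nat <= v n).
{ intros n m; induction m; [rewrite Nat.add_0_r; lra|].
  rewrite Nat.add_succ_r; eapply Rle_trans; [apply Hv|exact IHm]. }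
assert (UV : forall n m, u m <= v n).
{ intros n m; apply Rle_trans with (u (m + n)%nat); [apply U|].
  apply Rle_trans with (v (m + n)%nat); [apply Huv|].
  rewrite Nat.add_comm; apply V. }
destruct (completeness (fun r => exists n, r = u n)) as [s [Hs1 Hs2]].
- exists (v 0%nat); intros r [n ->]; apply UV.
- exists (u 0%nat), 0%nat; auto.
- exists s; intros n; split; [apply Hs1; exists n; auto|].
  apply Hs2; intros r [m ->]; apply UV.
Qed.

(** Goursat's bisection, separated from integration: of four quarters one keeps at least a quarter
    of the value, so the n-th rectangle carries at least [Rabs (J a b c d) / 4 ^ n]. Its squared
    sides also shrink like [4 ^ n], and the local bound at the common point contradicts this unless
    the value is 0. *)
Lemma rectangle_function_eq0 (J : R -> R -> R -> R -> R) (a b c d : R) :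
  a < b -> c < d ->
  (forall a' m b' c' d', a <= a' -> a' <= m -> m <= b' -> b' <= b -> c <= c' -> c' <= d' -> d' <= d ->
     J a' b' c' d' = J a' m c' d' + J m b' c' d') ->
  (forall a' b' c' m d', a <= a' -> a' <= b' -> b' <= b -> c <= c' -> c' <= m -> m <= d' -> d' <= d ->
     J a' b' c' d' = J a' b' c' m + J a' b' m d') ->
  (forall s t, a <= s <= b -> c <= t <= d -> forall eps, 0 < eps -> exists delta, 0 < delta /\
     forall a' b' c' d', a <= a' <= s -> s <= b' <= b -> c <= c' <= t -> t <= d' <= d ->
       b' - a' < delta -> d' - c' < delta ->
       Rabs (J a' b' c' d') <= eps * ((b' - a') ^ 2 + (d' - c') ^ 2)) ->
  J a b c d = 0.
Proof.
intros Hab Hcd H1 H2 Hloc.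
set (L := b - a); set (M := d - c).
set (w := fun n => L / 2 ^ n); set (h := fun n => M / 2 ^ n).
set (K := fun n (p : R * R) => Rabs (J (fst p) (fst p + w n) (snd p) (snd p + h n))).
set (step := fun n (p : R * R) =>
  let q1 := (fst p, snd p) in
  let q2 := (fst p + w (S n), snd p) in
  let q3 := (fst p, snd p + h (S n)) in
  let q4 := (fst p + w (S n), snd p + h (S n)) in
  if Rle_dec (K n p / 4) (K (S n) q1) then q1 else
  if Rle_dec (K n p / 4) (K (S n) q2) then q2 else
  if Rle_dec (K n p / 4) (K (S n) q3) then q3 else q4).
set (pos := fix pos n := match n with O => (a, c) | S n => step n (pos n) end).
assert (P2 : forall n, 0 < 2 ^ n) by (intros; apply pow_lt; lra).
assert (W0 : forall n, 0 < w n) by (intros n; apply Rdiv_lt_0_compat; unfold L; auto; lra).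
assert (H0 : forall n, 0 < h n) by (intros n; apply Rdiv_lt_0_compat; unfold M; auto; lra).
assert (WS : forall n, w n = w (S n) + w (S n)).
{ intros n; unfold w; simpl; field; generalize (P2 n); lra. }
assert (HS : forall n, h n = h (S n) + h (S n)).
{ intros n; unfold h; simpl; field; generalize (P2 n); lra. }
assert (Step : forall n, (fst (pos (S n)) = fst (pos n) \/ fst (pos (S n)) = fst (pos n) + w (S n)) /\
                (snd (pos (S n)) = snd (pos n) \/ snd (pos (S n)) = snd (pos n) + h (S n))).
{ intros n; change (pos (S n)) with (step n (pos n)); unfold step; cbv zeta.
  repeat match goal with |- context [Rle_dec ?x ?y] => destruct (Rle_dec x y) end;
    simpl; auto. }
assert (In : forall n, a <= fst (pos n) /\ fst (pos n) + w n <= b /\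
                       c <= snd (pos n) /\ snd (pos n) + h n <= d).
{ induction n.
  - unfold w, h, L, M; simpl; lra.
  - generalize (WS n) (HS n) (W0 (S n)) (H0 (S n)); destruct (Step n) as [[->| ->] [->| ->]]; lra. }
assert (KS : forall n, K n (pos n) / 4 <= K (S n) (pos (S n))).
{ intros n; change (pos (S n)) with (step n (pos n)); unfold step; cbv zeta.
  repeat match goal with |- context [Rle_dec ?x ?y] =>
    let N := fresh "N" in destruct (Rle_dec x y) as [|N]; [auto|] end.
  (* Only the default choice, the fourth quarter, remains: the other three fall short of a quarter
     of the value, so additivity and the triangle inequality force the fourth to reach it. *)
  apply Rnot_le_lt in N, N0, N1.
  destruct (In n) as [I1 [I2 [I3 I4]]].
  generalize (WS n) (HS n) (W0 (S n)) (H0 (S n)); intros E1 E2 E3 E4.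
  revert N N0 N1; unfold K; simpl fst; simpl snd.
  set (p := fst (pos n)) in *; set (q := snd (pos n)) in *.
  rewrite E1, E2, <- !Rplus_assoc.
  rewrite (H1 p (p + w (S n)) (p + w (S n) + w (S n))) by lra.
  rewrite (H2 p _ q (q + h (S n)) (q + h (S n) + h (S n))) by lra.
  rewrite (H2 _ (p + w (S n) + w (S n)) q (q + h (S n)) (q + h (S n) + h (S n))) by lra.
  set (j1 := J _ _ q _); set (j2 := J _ _ _ _); set (j3 := J _ _ _ _); set (j4 := J _ _ _ _).
  generalize (Rabs_triang (j1 + j2) (j3 + j4)) (Rabs_triang j1 j2) (Rabs_triang j3 j4).
  lra. }
assert (KB : forall n, Rabs (J a b c d) / 4 ^ n <= K n (pos n)).
{ induction n.
  - unfold K, w, h, L, M; simpl.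
    replace (a + (b - a) / 1) with b by field; replace (c + (d - c) / 1) with d by field; lra.
  - eapply Rle_trans; [|apply KS].
    replace (Rabs (J a b c d) / 4 ^ S n) with (Rabs (J a b c d) / 4 ^ n / 4); [lra|].
    simpl; field; apply pow_nonzero; lra. }
destruct (nested_intervals (fun n => fst (pos n)) (fun n => fst (pos n) + w n)) as [s Hs].
{ intros n; generalize (W0 (S n)); destruct (Step n) as [[->| ->] _]; lra. }
{ intros n; generalize (WS n) (W0 (S n)); destruct (Step n) as [[->| ->] _]; lra. }
{ intros n; generalize (W0 n); lra. }
destruct (nested_intervals (fun n => snd (pos n)) (fun n => snd (pos n) + h n)) as [t Ht].
{ intros n; generalize (H0 (S n)); destruct (Step n) as [_ [->| ->]]; lra. }
{ intros n; generalize (HS n) (H0 (S n)); destruct (Step n) as [_ [->| ->]]; lra. }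
{ intros n; generalize (H0 n); lra. }
destruct (Req_dec (J a b c d) 0) as [E|E]; auto; exfalso.
apply Rabs_pos_lt in E.
assert (LM : 0 < L ^ 2 + M ^ 2) by (unfold L, M; nra).
(* With this [eps] the local upper bound at stage n is exactly half of the lower bound [KB]. *)
destruct (Hloc s t) with (eps := Rabs (J a b c d) / (2 * (L ^ 2 + M ^ 2))) as [delta [Hd Hl]].
{ generalize (Hs 0%nat) (In 0%nat); simpl; lra. }
{ generalize (Ht 0%nat) (In 0%nat); simpl; lra. }
{ apply Rdiv_lt_0_compat; lra. }
assert (Hn : exists n, L / 2 ^ n < delta /\ M / 2 ^ n < delta).
{ assert (Y : 0 < delta / (L + M)) by (apply Rdiv_lt_0_compat; unfold L, M; lra).
  destruct (pow_lt_1_zero (/ 2)) with (y := delta / (L + M)) as [N HN]; auto.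
  { rewrite Rabs_pos_eq; lra. }
  exists N; specialize (HN N (le_n _)).
  rewrite Rabs_pos_eq in HN by (left; apply pow_lt; lra).
  rewrite pow_inv in HN.
  apply Rmult_lt_compat_r with (r := L + M) in HN; [|unfold L, M; lra].
  unfold Rdiv in HN; rewrite Rmult_assoc, Rinv_l in HN by (unfold L, M; lra).
  generalize (Rinv_0_lt_compat _ (P2 N)); unfold Rdiv.
  assert (0 < L /\ 0 < M) by (unfold L, M; lra); nra. }
destruct Hn as [n [Hn1 Hn2]].
destruct (In n) as [I1 [I2 [I3 I4]]].
specialize (Hl (fst (pos n)) (fst (pos n) + w n) (snd (pos n)) (snd (pos n) + h n)).
specialize (Hs n); specialize (Ht n); simpl in Hs, Ht.
fold (w n) in Hn1; fold (h n) in Hn2.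
assert (Hl' := Hl ltac:(lra) ltac:(lra) ltac:(lra) ltac:(lra) ltac:(lra) ltac:(lra)).
generalize (KB n); unfold K; intros KBn.
assert (Q : 0 < 4 ^ n) by (apply pow_lt; lra).
replace (Rabs (J a b c d) / (2 * (L ^ 2 + M ^ 2)) *
  ((fst (pos n) + w n - fst (pos n)) ^ 2 + (snd (pos n) + h n - snd (pos n)) ^ 2))
  with (Rabs (J a b c d) / 4 ^ n / 2) in Hl'.
- assert (0 < Rabs (J a b c d) / 4 ^ n) by (apply Rdiv_lt_0_compat; auto); lra.
- replace (4 ^ n) with (2 ^ n * 2 ^ n) by (rewrite <- Rpow_mult_distr; f_equal; lra).
  unfold w, h; field; generalize (P2 n); lra.
Qed.

(** * Contour integrals in polar coordinates about the evaluation point *)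

Definition cis (t : R) : Cx := mkC (cos t) (sin t).

Lemma cis_onT (t : R) : onT (cis t).
Proof.
unfold onT, Cnorm, Cnorm2, cis; simpl.
generalize (sin2_cos2 t); unfold Rsqr; intros H.
replace (cos t * cos t + sin t * sin t) with 1 by lra; apply sqrt_1.
Qed.

Lemma clim_RtoC (t : R) : clim (locally t) RtoC (RtoC t).
Proof.
apply clim_re_im; split; [exact (continuous_id t)|exact (continuous_const 0 t)].
Qed.

Lemma clim_cis (t : R) : clim (locally t) cis (cis t).
Proof.
apply clim_re_im; split; [apply (continuous_cos t)|apply (continuous_sin t)].
Qed.

Lemma clim_continuous_re (g : R -> Cx) (t : R) :
  clim (locally t) g (g t) -> continuous (fun t => Cre (g t)) t.
Proof. intros H; apply (proj1 (proj1 (clim_re_im _ _) H)). Qed.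

Lemma cis_lipschitz (s t : R) : Cnorm (cis s - cis t) <= 2 * Rabs (s - t).
Proof.
eapply Rle_trans; [apply Cnorm_le_re_im|].
simpl; fold (cos s - cos t) (sin s - sin t).
assert (A : Rabs (cos s - cos t) <= 1 * Rabs (s - t)).
{ apply bounded_variation with (fun t => - sin t); intros r _; split.
  - auto_derive; auto; ring.
  - rewrite Rabs_Ropp; apply Rabs_le, SIN_bound. }
assert (B : Rabs (sin s - sin t) <= 1 * Rabs (s - t)).
{ apply bounded_variation with (fun t => cos t); intros r _; split.
  - auto_derive; auto; ring.
  - apply Rabs_le, COS_bound. }
unfold Rminus in *; lra.
Qed.

(** Used along one edge, with [p] coming from the affine part of the integrand: only the remainder
    [f - p] contributes to the estimate. *)
Lemma RInt_sub_primitive (f P p : R -> R) (a b M : R) : a <= b ->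
  (forall t, a <= t <= b -> continuous f t) ->
  (forall t, a <= t <= b -> is_derive P t (p t)) ->
  (forall t, a <= t <= b -> continuous p t) ->
  (forall t, a <= t <= b -> Rabs (f t - p t) <= M) ->
  Rabs (RInt f a b - (P b - P a)) <= (b - a) * M.
Proof.
intros Hab Cf DP Cp HM.
assert (E1 : is_RInt f a b (RInt f a b)).
{ apply (RInt_correct f), (ex_RInt_continuous (V := R_CompleteNormedModule)).
  rewrite Rmin_left, Rmax_right by auto; auto. }
assert (E2 : is_RInt p a b (P b - P a)).
{ apply (is_RInt_derive P p); rewrite Rmin_left, Rmax_right by auto; auto. }
exact (norm_RInt_le_const (fun t => minus (f t) (p t)) _ _ _ _ Hab HM (is_RInt_minus _ _ _ _ _ _ E1 E2)).
Qed.

(** The closed disc as a cone with vertex [x] over the circle. For fixed [t] the curve is the unit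
    circle shrunk towards [x], and for fixed [th] it is a segment from [x]. A rectangle in [t] and
    [th] therefore joins the unit circle to small circles around [x]. *)
Definition cone (x : Cx) (t th : R) : Cx := (x + RtoC t * (cis th - x))%cx.

Definition cone_form_t (F : Cx -> Cx) (x : Cx) (t th : R) : R :=
  Cre (F (cone x t th) * (cis th - x)).

Definition cone_form_th (F : Cx -> Cx) (x : Cx) (t th : R) : R :=
  Cre (F (cone x t th) * (RtoC t * (Ci * cis th))).

(* The real part of the integral of [F dz] along the image under [cone x] of the boundary of a rectangle. *)
Definition cone_contour (F : Cx -> Cx) (x : Cx) (a b c d : R) : R :=
  RInt (fun t => cone_form_t F x t c) a b + RInt (fun th => cone_form_th F x b th) c d
  - RInt (fun t => cone_form_t F x t d) a b - RInt (fun th => cone_form_th F x a th) c d.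

Lemma clim_cone_t (x : Cx) (t th : R) : clim (locally t) (fun t => cone x t th) (cone x t th).
Proof.
apply clim_add; [apply clim_const|apply clim_mul; [apply clim_RtoC|apply clim_const]].
Qed.

Lemma clim_cone_th (x : Cx) (t th : R) : clim (locally th) (cone x t) (cone x t th).
Proof.
apply clim_add; [apply clim_const|apply clim_mul; [apply clim_const|]].
apply clim_sub; [apply clim_cis|apply clim_const].
Qed.

Lemma cone_form_t_continuous (F : Cx -> Cx) (x : Cx) (t th : R) :
  ccont F (cone x t th) -> continuous (fun t => cone_form_t F x t th) t.
Proof.
intros H; apply clim_continuous_re, clim_mul; [|apply clim_const].
exact (clim_comp _ _ _ H (clim_cone_t x t th)).
Qed.

Lemma cone_form_th_continuous (F : Cx -> Cx) (x : Cx) (t th : R) :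
  ccont F (cone x t th) -> continuous (fun th => cone_form_th F x t th) th.
Proof.
intros H; apply clim_continuous_re, clim_mul.
- exact (clim_comp _ _ _ H (clim_cone_th x t th)).
- repeat apply clim_mul; try apply clim_const; apply clim_cis.
Qed.

Lemma cone_lipschitz (x : Cx) (s t u v : R) : Cnorm x <= 1 -> 0 <= t <= 1 ->
  Cnorm (cone x s u - cone x t v) <= 2 * (Rabs (s - t) + Rabs (u - v)).
Proof.
intros Hx Ht.
replace (cone x s u - cone x t v)%cx
  with (RtoC (s - t) * (cis u - x) + RtoC t * (cis u - cis v))%cx
  by (unfold cone; cx_ring).
eapply Rle_trans; [apply Cnorm_triangle|].
rewrite !Cnorm_mul, !Cnorm_RtoC, (Rabs_pos_eq t) by lra.
generalize (Cnorm_sub_triangle (cis u) x) (cis_lipschitz u v) (Rabs_pos (s - t)) (Rabs_pos (u - v)).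
rewrite (cis_onT u); generalize (Cnorm_ge0 (cis u - cis v)); nra.
Qed.

(** The bisection is carried out on the parameter rectangle, not on its image; [cone_lipschitz]
    compares the two sizes. Additivity of the contour integral is Chasles's relation, the common
    edges cancelling. *)
Lemma goursat (F : Cx -> Cx) (x : Cx) (a b c d : R) :
  Cnorm x <= 1 -> 0 <= a -> a < b -> b <= 1 -> c < d ->
  (forall t th, a <= t <= b -> c <= th <= d -> exists l, cdiff F (cone x t th) l) ->
  cone_contour F x a b c d = 0.
Proof.
intros Hx Ha Hab Hb Hcd HF.
assert (CF : forall t th, a <= t <= b -> c <= th <= d -> ccont F (cone x t th)).
{ intros t th H1 H2; destruct (HF t th H1 H2) as [l Hl]; apply (cdiff_cont _ _ _ Hl). }
assert (It : forall p q th, a <= p -> p <= q -> q <= b -> c <= th <= d ->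
  ex_RInt (fun t => cone_form_t F x t th) p q).
{ intros p q th H1 H2 H3 H4; apply (ex_RInt_continuous (V := R_CompleteNormedModule)).
  rewrite Rmin_left, Rmax_right by auto; intros t Ht.
  apply cone_form_t_continuous, CF; lra. }
assert (Ith : forall p q t, c <= p -> p <= q -> q <= d -> a <= t <= b ->
  ex_RInt (fun th => cone_form_th F x t th) p q).
{ intros p q t H1 H2 H3 H4; apply (ex_RInt_continuous (V := R_CompleteNormedModule)).
  rewrite Rmin_left, Rmax_right by auto; intros th Hth.
  apply cone_form_th_continuous, CF; lra. }
apply rectangle_function_eq0; auto.
- intros a' m b' c' d' A1 A2 A3 A4 A5 A6 A7; unfold cone_contour.
  rewrite <- (RInt_Chasles (fun t => cone_form_t F x t c') a' m b') by (apply It; lra).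
  rewrite <- (RInt_Chasles (fun t => cone_form_t F x t d') a' m b') by (apply It; lra).
  unfold plus; simpl; ring.
- intros a' b' c' m d' A1 A2 A3 A4 A5 A6 A7; unfold cone_contour.
  rewrite <- (RInt_Chasles (fun th => cone_form_th F x b' th) c' m d') by (apply Ith; lra).
  rewrite <- (RInt_Chasles (fun th => cone_form_th F x a' th) c' m d') by (apply Ith; lra).
  unfold plus; simpl; ring.
- intros s t Hs Ht eps Heps.
  destruct (HF s t Hs Ht) as [l [q [Cq [<- [d1 [Hd1 E]]]]]].
  set (z0 := cone x s t) in *.
  (* Points of a small rectangle lie within [2 * w] of [z0], and the tangent vectors have modulus at
     most 2, so the remainder of the integrand is at most [eps * w / 4]. The four edges have total
     length [2 * w], and [w * w / 2] is at most the sum of the squared sides. The factor 8 in the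
     choice of the radius below keeps [2 * w] under both [d1] and [d2]. *)
  assert (He : 0 < eps / 16) by lra.
  destruct (Cq _ He) as [d2 [Hd2 Q]].
  assert (Hdm : 0 < Rmin d1 d2) by (apply Rmin_pos; auto).
  exists (Rmin d1 d2 / 8); split; [lra|].
  generalize (Rmin_l d1 d2) (Rmin_r d1 d2); intros M1 M2.
  intros a' b' c' d' A1 A2 A3 A4 A5 A6.
  (* Up to a remainder, F agrees near z0 with an affine function, whose contour integral
     vanishes because it has the primitive P. *)
  set (P := fun u v => Cre (F z0 * cone x u v
                + RtoC (1/2) * q z0 * ((cone x u v - z0) * (cone x u v - z0)))%cx).
  set (Lin := fun z => (F z0 + q z0 * (z - z0))%cx).
  set (w := (b' - a') + (d' - c')).
  assert (R0 : forall u v, a' <= u <= b' -> c' <= v <= d' ->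
    Cnorm (F (cone x u v) - Lin (cone x u v)) <= eps / 16 * (2 * w)).
  { intros u v Hu Hv.
    assert (B : Cnorm (cone x u v - z0) <= 2 * w).
    { eapply Rle_trans; [apply cone_lipschitz; lra|].
      apply Rmult_le_compat_l; [lra|]; unfold w.
      apply Rplus_le_compat; apply Rabs_le; lra. }
    replace (F (cone x u v) - Lin (cone x u v))%cx with ((q (cone x u v) - q z0) * (cone x u v - z0))%cx.
    2: { unfold Lin; specialize (E (cone x u v)).
         replace (F (cone x u v)) with (F (cone x u v) - F z0 + F z0)%cx by ring.
         rewrite E; [ring|]; unfold w in B; lra. }
    rewrite Cnorm_mul; apply Rmult_le_compat; try apply Cnorm_ge0; auto.
    left; apply Q; unfold w in B; lra. }
  assert (Rt : forall u v, a' <= u <= b' -> c' <= v <= d' ->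
    Rabs (cone_form_t F x u v - cone_form_t Lin x u v) <= eps * w / 4).
  { intros u v Hu Hv; unfold cone_form_t.
    replace (Cre (F (cone x u v) * (cis v - x)) - Cre (Lin (cone x u v) * (cis v - x)))
      with (Cre ((F (cone x u v) - Lin (cone x u v)) * (cis v - x))) by (cx_unfold; ring).
    eapply Rle_trans; [apply Cre_le_norm|]; rewrite Cnorm_mul.
    generalize (R0 u v Hu Hv) (Cnorm_sub_triangle (cis v) x) (Cnorm_ge0 (cis v - x))
      (Cnorm_ge0 (F (cone x u v) - Lin (cone x u v))); rewrite (cis_onT v).
    assert (0 <= w) by (unfold w; lra); nra. }
  assert (Rth : forall u v, a' <= u <= b' -> c' <= v <= d' ->
    Rabs (cone_form_th F x u v - cone_form_th Lin x u v) <= eps * w / 4).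
  { intros u v Hu Hv; unfold cone_form_th.
    replace (Cre (F (cone x u v) * (RtoC u * (Ci * cis v))) - Cre (Lin (cone x u v) * (RtoC u * (Ci * cis v))))
      with (Cre ((F (cone x u v) - Lin (cone x u v)) * (RtoC u * (Ci * cis v)))) by (cx_unfold; ring).
    eapply Rle_trans; [apply Cre_le_norm|]; rewrite !Cnorm_mul, Cnorm_RtoC, (cis_onT v).
    assert (Ei : Cnorm Ci = 1).
    { unfold Cnorm, Cnorm2, Ci; simpl; replace (0 * 0 + 1 * 1) with 1 by ring; apply sqrt_1. }
    rewrite Ei, Rabs_pos_eq by lra.
    generalize (R0 u v Hu Hv) (Cnorm_ge0 (F (cone x u v) - Lin (cone x u v))).
    assert (0 <= w) by (unfold w; lra); nra. }
  assert (Cl : forall z, ccont Lin z).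
  { intros z; apply clim_add; [apply clim_const|]; apply clim_mul; [apply clim_const|].
    apply clim_sub; [apply ccont_id|apply clim_const]. }
  assert (Dt : forall u v, is_derive (fun u => P u v) u (cone_form_t Lin x u v)).
  { intros u v; unfold P, cone_form_t, Lin, cone; cx_unfold; auto_derive; auto; field. }
  assert (Dth : forall u v, is_derive (P u) v (cone_form_th Lin x u v)).
  { intros u v; unfold P, cone_form_th, Lin, cone; cx_unfold; auto_derive; auto; field. }
  assert (S1 : forall v, c' <= v <= d' ->
    Rabs (RInt (fun t => cone_form_t F x t v) a' b' - (P b' v - P a' v)) <= (b' - a') * (eps * w / 4)).
  { intros v Hv; apply RInt_sub_primitive with (P := fun u => P u v) (p := fun u => cone_form_t Lin x u v).
    - lra.
    - intros u Hu; apply cone_form_t_continuous, CF; lra.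
    - intros; apply Dt.
    - intros u Hu; apply cone_form_t_continuous, Cl.
    - intros; apply Rt; auto. }
  assert (S2 : forall u, a' <= u <= b' ->
    Rabs (RInt (fun th => cone_form_th F x u th) c' d' - (P u d' - P u c')) <= (d' - c') * (eps * w / 4)).
  { intros u Hu; apply RInt_sub_primitive with (p := fun v => cone_form_th Lin x u v).
    - lra.
    - intros v Hv; apply cone_form_th_continuous, CF; lra.
    - intros; apply Dth.
    - intros v Hv; apply cone_form_th_continuous, Cl.
    - intros; apply Rth; auto. }
  generalize (S1 c' ltac:(lra)) (S1 d' ltac:(lra)) (S2 a' ltac:(lra)) (S2 b' ltac:(lra)).
  unfold cone_contour.
  set (I1 := RInt (fun t => cone_form_t F x t c') a' b').
  set (I2 := RInt (fun t => cone_form_t F x t d') a' b').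
  set (I3 := RInt (fun th => cone_form_th F x a' th) c' d').
  set (I4 := RInt (fun th => cone_form_th F x b' th) c' d').
  intros B1 B2 B3 B4; apply Rabs_le_between in B1, B2, B3, B4.
  assert (W : w * (eps * w / 4) * 2 <= eps * ((b' - a') ^ 2 + (d' - c') ^ 2)).
  { replace (w * (eps * w / 4) * 2) with (eps * (w * w / 2)) by field.
    apply Rmult_le_compat_l; [lra|]; unfold w.
    generalize (pow2_ge_0 ((b' - a') - (d' - c'))); simpl; lra. }
  apply Rabs_le; unfold w at 1 in W; lra.
Qed.

(** By [goursat] the integral of the difference quotient over the unit circle equals the one over
    the circle shrunk by [t] towards [x], and the latter tends to 0 by continuity at [x].
    Differentiability is asked only away from [x], so that quotients with a removable singularity
    are covered. *)
Lemma is_RInt_cauchy (f : Cx -> Cx) (x : Cx) : inD x ->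
  (forall z, Cnorm z <= 1 -> z <> x -> exists l, cdiff f z l) -> ccont f x ->
  is_RInt (fun th => Cre ((f (cis th) - f x) * (cis th / (cis th - x)))) 0 (2 * PI) 0.
Proof.
intros Hx Df Cfx; unfold inD in Hx; generalize PI_RGT_0; intros Hpi.
(* The factor [- Ci] cancels the [Ci] in the differential of [cis]. *)
set (F := fun z => (- Ci * (f z - f x) / (z - x))%cx).
assert (N1 : forall t th, 0 <= t <= 1 -> Cnorm (cone x t th) <= 1).
{ intros t th Ht.
  replace (cone x t th) with (RtoC (1 - t) * x + RtoC t * cis th)%cx by (unfold cone; cx_ring).
  eapply Rle_trans; [apply Cnorm_triangle|].
  rewrite !Cnorm_mul, !Cnorm_RtoC, (cis_onT th), !Rabs_pos_eq by lra; nra. }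
assert (Nz : forall th, (cis th - x)%cx <> C0) by (intros; apply onT_sub_neq0; [apply cis_onT|auto]).
assert (N2 : forall t th, 0 < t -> cone x t th <> x).
{ intros t th Ht E; apply (Nz th).
  replace (cis th - x)%cx with (Cinv (RtoC t) * (cone x t th - x))%cx.
  - rewrite E; ring.
  - unfold cone; field; apply RtoC_neq0; lra. }
assert (DF : forall t th, 0 < t <= 1 -> exists l, cdiff F (cone x t th) l).
{ intros t th Ht; destruct (Df (cone x t th)) as [l Hl]; [apply N1; lra|apply N2; lra|].
  eexists; apply cdiff_div.
  - apply Csub_neq0, N2; lra.
  - apply cdiff_mul; [apply cdiff_const|apply cdiff_add; [exact Hl|apply cdiff_const]].
  - apply cdiff_add; [apply cdiff_id|apply cdiff_const]. }
assert (Fth : forall t th, 0 < t ->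
  cone_form_th F x t th = Cre ((f (cone x t th) - f x) * (cis th / (cis th - x)))).
{ intros t th Ht; unfold cone_form_th, F; f_equal.
  replace (cone x t th - x)%cx with (RtoC t * (cis th - x))%cx by (unfold cone; ring).
  replace (f (cone x t th) - f x)%cx
    with (- (Ci * Ci) * (f (cone x t th) - f x))%cx at 2
    by (replace (- (Ci * Ci))%cx with C1 by cx_ring; ring).
  field; split; auto; apply RtoC_neq0; lra. }
assert (C1x : forall th, cone x 1 th = cis th) by (intros; unfold cone; fold C1; ring).
assert (Ex : forall t, 0 < t <= 1 -> ex_RInt (fun th => cone_form_th F x t th) 0 (2 * PI)).
{ intros t Ht; apply (ex_RInt_continuous (V := R_CompleteNormedModule)); intros th _.
  apply cone_form_th_continuous; destruct (DF t th Ht) as [l Hl]; apply (cdiff_cont _ _ _ Hl). }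
assert (EI : forall t, 0 < t < 1 ->
  RInt (fun th => cone_form_th F x 1 th) 0 (2 * PI) = RInt (fun th => cone_form_th F x t th) 0 (2 * PI)).
{ intros t Ht.
  assert (G : cone_contour F x t 1 0 (2 * PI) = 0).
  { apply goursat; try lra; intros; apply DF; lra. }
  unfold cone_contour in G.
  (* The two radial edges are the same segment, so their contributions cancel. *)
  assert (Ec : cis (2 * PI) = cis 0) by (unfold cis; rewrite cos_2PI, sin_2PI, cos_0, sin_0; auto).
  unfold cone_form_t, cone in G; rewrite Ec in G; lra. }
(* The weight [cis th / (cis th - x)] is independent of [t] and bounded by [1 / (1 - Cnorm x)]; an
   integrand below [eps / (4 * PI)] on a length [2 * PI] gives [eps / 2]. *)
assert (Z : RInt (fun th => cone_form_th F x 1 th) 0 (2 * PI) = 0).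
{ apply cond_eq; intros eps He; rewrite Rminus_0_r.
  assert (He' : 0 < eps * (1 - Cnorm x) / (4 * PI)) by (apply Rdiv_lt_0_compat; nra).
  destruct (Cfx _ He') as [d [Hd Hc]].
  assert (Hm : 0 < Rmin (1/2) (d / 4)) by (apply Rmin_pos; lra).
  set (t := Rmin (1/2) (d / 4)) in *.
  assert (Ht1 : t <= 1/2) by apply Rmin_l.
  assert (Ht2 : t <= d / 4) by apply Rmin_r.
  rewrite (EI t) by lra.
  apply Rle_lt_trans with ((2 * PI - 0) * (eps / (4 * PI))).
  - apply abs_RInt_le_const; [lra|apply Ex; lra|]; intros th _.
    rewrite Fth by lra.
    eapply Rle_trans; [apply Cre_le_norm|]; rewrite Cnorm_mul, Cnorm_div, (cis_onT th) by auto.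
    assert (B : Cnorm (f (cone x t th) - f x) < eps * (1 - Cnorm x) / (4 * PI)).
    { apply Hc; replace (cone x t th - x)%cx with (RtoC t * (cis th - x))%cx by (unfold cone; ring).
      rewrite Cnorm_mul, Cnorm_RtoC, Rabs_pos_eq by lra.
      generalize (Cnorm_sub_triangle (cis th) x); rewrite (cis_onT th).
      generalize (Cnorm_ge0 (cis th - x)); nra. }
    assert (G : 1 - Cnorm x <= Cnorm (cis th - x)).
    { generalize (Cnorm_sub_ge (cis th) x); rewrite (cis_onT th); auto. }
    replace (eps / (4 * PI)) with (eps * (1 - Cnorm x) / (4 * PI) * / (1 - Cnorm x)) by (field; lra).
    apply Rmult_le_compat; [apply Cnorm_ge0| | lra |].
    + unfold Rdiv; rewrite Rmult_1_l; left; apply Rinv_0_lt_compat; lra.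
    + unfold Rdiv; rewrite Rmult_1_l; apply Rinv_le_contravar; lra.
  - replace ((2 * PI - 0) * (eps / (4 * PI))) with (eps / 2) by (field; lra); lra. }
generalize (RInt_correct _ _ _ (Ex 1 ltac:(lra))); rewrite Z.
apply is_RInt_ext; intros th _; rewrite Fth, C1x by lra; auto.
Qed.

(** * Integral representations on the circle *)

Lemma is_RInt_congr (f g : R -> R) (a b l l' : R) : is_RInt f a b l ->
  (forall t, f t = g t) -> l = l' -> is_RInt g a b l'.
Proof. intros H E <-; revert H; apply is_RInt_ext; auto. Qed.

Lemma is_RInt_mean_value (f : Cx -> Cx) :
  (forall z, Cnorm z <= 1 -> z <> C0 -> exists l, cdiff f z l) -> ccont f C0 ->
  is_RInt (fun th => Cre (f (cis th))) 0 (2 * PI) (2 * PI * Cre (f C0)).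
Proof.
intros Df Cf.
assert (H0 : inD C0) by (unfold inD; rewrite Cnorm0; lra).
generalize (is_RInt_cauchy f C0 H0 Df Cf); intros H.
eapply is_RInt_congr; [exact (is_RInt_plus _ _ _ _ _ _ H (is_RInt_const 0 (2 * PI) (Cre (f C0))))| |].
2: unfold plus, scal; simpl; unfold mult; simpl; ring.
intros th.
generalize (onT_neq0 _ (cis_onT th)); intros N.
replace (cis th / (cis th - 0))%cx with C1.
- unfold plus; cx_unfold; ring.
- field; intros E; apply N; rewrite <- E; ring.
Qed.

Definition herglotz_kernel (w z : Cx) : Cx := ((w + z) / (w - z))%cx.

Section Herglotz.
Variable g : Cx -> Cx.
Hypothesis Dg : forall z, Cnorm z <= 1 -> exists l, cdiff g z l.

(** With k = w / (w - x) the kernel is 2k - 1, and 2 Re g Re ck is the real part of gck plus that of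
    g times the conjugate of ck. The first is handled by Cauchy's formula. For the second, on the
    circle the conjugate of k is 1 / (1 - x^* w), which is holomorphic, so the mean value property
    applies to [H]. The extra constants [c * g x] enter once with k and once conjugated, and cancel.
    The term in [Cim (g C0)] is the imaginary constant that the real part of [g] cannot see. *)
Lemma herglotz (x c : Cx) : inD x ->
  is_RInt (fun th => Cre (g (cis th)) * Cre (c * herglotz_kernel (cis th) x)) 0 (2 * PI)
    (2 * PI * Cre (c * (g x - RtoC (Cim (g C0)) * Ci))).
Proof.
intros Hx.
assert (Cg : forall z, Cnorm z <= 1 -> ccont g z).
{ intros z Hz; destruct (Dg z Hz) as [l Hl]; apply (cdiff_cont _ _ _ Hl). }
assert (N0 : Cnorm C0 <= 1) by (rewrite Cnorm0; lra).
assert (Nx : Cnorm x <= 1) by (unfold inD in Hx; lra).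
set (H := fun z => (((c * g x)^* + c^* * g z) / (1 - x^* * z))%cx).
assert (DH : forall z, Cnorm z <= 1 -> exists l, cdiff H z l).
{ intros z Hz; destruct (Dg z Hz) as [l Hl]; eexists; apply cdiff_div.
  - generalize (one_sub_mul_conj_neq0 x^* z^*).
    rewrite !Cnorm_conj, Cconj_invol; auto.
  - apply cdiff_add; [apply cdiff_const|apply cdiff_mul; [apply cdiff_const|exact Hl]].
  - apply cdiff_add; [apply cdiff_const|].
    apply cdiff_opp, cdiff_mul; [apply cdiff_const|apply cdiff_id]. }
assert (I1 := is_RInt_cauchy (fun z => c * g z)%cx x Hx).
assert (I2 := is_RInt_mean_value H).
assert (I3 := is_RInt_mean_value (fun z => RtoC (Cre c) * g z)%cx).
assert (Dcg : forall k z, Cnorm z <= 1 -> exists l, cdiff (fun z => k * g z)%cx z l).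
{ intros k z Hz; destruct (Dg z Hz) as [l Hl]; eexists; apply cdiff_mul; [apply cdiff_const|exact Hl]. }
assert (Ccg : forall k z, Cnorm z <= 1 -> ccont (fun z => k * g z)%cx z).
{ intros k z Hz; destruct (Dcg k z Hz) as [l Hl]; apply (cdiff_cont _ _ _ Hl). }
specialize (I1 ltac:(auto) ltac:(auto)).
specialize (I2 ltac:(auto) ltac:(destruct (DH C0 N0) as [l Hl]; apply (cdiff_cont _ _ _ Hl))).
specialize (I3 ltac:(auto) ltac:(auto)).
eapply is_RInt_congr; [exact (is_RInt_minus _ _ _ _ _ _ (is_RInt_plus _ _ _ _ _ _ I1 I2) I3)| |].
- intros th.
  generalize (onT_sub_neq0 _ _ (cis_onT th) Hx); intros N.
  set (k := (cis th / (cis th - x))%cx).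
  assert (Ek : (1 / (1 - x^* * cis th))%cx = (k^*)%cx).
  { unfold k; autorewrite with cconj; rewrite (onT_conj_inv (cis th)) by apply cis_onT.
    generalize (onT_neq0 _ (cis_onT th)); intros N'.
    generalize (one_sub_mul_conj_neq0 x (cis th)); rewrite (cis_onT th).
    intros N''; specialize (N'' Hx (Rle_refl _)); apply Cconj_neq0 in N''.
    autorewrite with cconj in N''; field; repeat split; auto. }
  replace (herglotz_kernel (cis th) x) with (k + k - 1)%cx
    by (unfold k, herglotz_kernel; field; auto).
  replace (H (cis th)) with (((c * g x)^* + c^* * g (cis th)) * k^*)%cx
    by (rewrite <- Ek; unfold H, Cdiv; ring).
  generalize (g (cis th)) (g x); intros a b; unfold minus, plus, opp; cx_unfold; ring.
- replace (H C0) with ((c * g x)^* + c^* * g C0)%cx.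
  + unfold minus, plus, opp; cx_unfold; ring.
  + unfold H; field; intros E; apply (f_equal Cre) in E; cx_unfold; lra.
Qed.

(** Here 2 Re g Re cw is the real part of cwg plus that of c^* g / w, as 1 / w is the conjugate of w
    on the circle. Replacing g by g - g(0) in the second term removes the pole, and the last summand
    of [H] compensates. The mean value is then [H C0], which is 0 because the derivative at 0 is. *)
Lemma herglotz_moment (c : Cx) : cdiff g C0 C0 ->
  is_RInt (fun th => Cre (g (cis th)) * Cre (c * cis th)) 0 (2 * PI) 0.
Proof.
intros D0.
set (H := fun z => (c * z * g z + c^* * ((g z - g C0) / z) + c * (g C0)^* * z)%cx).
(* At 0 the quotient has numerator 0, so it is 0 whatever [Cinv C0] is; this is also its limit
   [q C0], hence [H] is continuous there. *)
assert (H0 : H C0 = C0) by (unfold H, Cdiv; ring).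
assert (DH : forall z, Cnorm z <= 1 -> z <> C0 -> exists l, cdiff H z l).
{ intros z Hz N; destruct (Dg z Hz) as [l Hl]; eexists.
  apply cdiff_add; [apply cdiff_add|]; apply cdiff_mul.
  - apply cdiff_mul; [apply cdiff_const|apply cdiff_id].
  - exact Hl.
  - apply cdiff_const.
  - apply cdiff_div; [auto|apply cdiff_add; [exact Hl|apply cdiff_const]|apply cdiff_id].
  - apply cdiff_const.
  - apply cdiff_id. }
assert (CH : ccont H C0).
{ generalize (cdiff_cont _ _ _ D0); intros Cg.
  destruct D0 as [q [Cq [q0 E]]]; unfold ccont.
  replace (H C0) with (c * C0 * g C0 + c^* * q C0 + c * (g C0)^* * C0)%cx by (rewrite H0, q0; ring).
  apply clim_ext_loc with (fun z => c * z * g z + c^* * q z + c * (g C0)^* * z)%cx.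
  - revert E; apply filter_imp; intros w E; unfold H; rewrite E.
    destruct (Req_dec (Cnorm w) 0) as [W|W].
    + apply Cnorm_eq0 in W; subst w; rewrite q0; unfold Cdiv; ring.
    + field; intros ->; apply W, Cnorm0.
  - repeat first [apply clim_add | apply clim_mul]; try apply clim_const; try apply ccont_id; auto. }
eapply is_RInt_congr; [exact (is_RInt_scal _ _ _ (1/2) _ (is_RInt_mean_value H DH CH))| |].
2: rewrite H0; unfold scal; simpl; unfold mult; simpl; ring.
intros th.
unfold H; replace ((g (cis th) - g C0) / cis th)%cx with ((g (cis th) - g C0) * (cis th)^*)%cx
  by (rewrite (onT_conj_inv (cis th)) by apply cis_onT; reflexivity).
generalize (g (cis th)) (g C0) (cis th); intros a b e.
unfold scal; simpl; unfold mult; simpl; cx_unfold; field.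
Qed.

End Herglotz.

(** * Balanced measures decompose over [Theta_hat] *)

Fixpoint lsum (Q : Cx -> R) (L : list (R * Cx)) : R :=
  match L with
  | nil => 0
  | (l, w) :: rest => l * Q w + lsum Q rest
  end.

(** Zero weights, repeated atoms and any total mass are allowed, so that the class is stable under
    the moves of the induction on the number of atoms. *)
Definition balanced (L : list (R * Cx)) : Prop :=
  Forall (fun p => 0 <= fst p /\ onT (snd p)) L /\ lsum Cre L = 0 /\ lsum Cim L = 0.

Definition cross (z w : Cx) : R := Cre z * Cim w - Cim z * Cre w.

Lemma onT_re_im (w : Cx) : onT w -> Cre w * Cre w + Cim w * Cim w = 1.
Proof.
unfold onT; intros H; generalize (Cnorm_sqr w); rewrite H; unfold Cnorm2; lra.
Qed.

(** Lagrange's identity: for unit vectors with zero determinant the inner product squares to 1. *)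
Lemma cross_eq0 (z w : Cx) : onT z -> onT w -> cross z w = 0 -> w = z \/ w = (- z)%cx.
Proof.
intros Hz Hw; apply onT_re_im in Hz, Hw; unfold cross.
destruct z as [a b], w as [c d]; simpl in *; intros E.
assert (D : (a * c + b * d) * (a * c + b * d) = 1).
{ replace ((a * c + b * d) * (a * c + b * d))
    with ((a * a + b * b) * (c * c + d * d) - (a * d - b * c) * (a * d - b * c)) by ring.
  rewrite Hz, Hw, E; ring. }
assert (D' : a * c + b * d = 1 \/ a * c + b * d = -1).
{ destruct (Rmult_integral (a * c + b * d - 1) (a * c + b * d + 1)); [ring_simplify; nra|left|right]; lra. }
assert (Ec : c = (a * c + b * d) * a).
{ replace ((a * c + b * d) * a) with ((a * a + b * b) * c + b * (a * d - b * c)) by ring.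
  rewrite Hz, E; ring. }
assert (Ed : d = (a * c + b * d) * b).
{ replace ((a * c + b * d) * b) with ((a * a + b * b) * d - a * (a * d - b * c)) by ring.
  rewrite Hz, E; ring. }
destruct D' as [D'|D']; rewrite D' in Ec, Ed; [left|right]; apply Cx_eq; simpl; lra.
Qed.

(** The time at which the ray from the weights in direction [snd] leaves the positive orthant, that
    is the least ratio [l / - d] over negative [d]. The head of the list replaces the exit time of
    the tail only if it turns negative before. *)
Lemma first_exit (L : list (R * R)) :
  Forall (fun p => 0 < fst p) L -> Exists (fun p => snd p < 0) L ->
  exists t, 0 < t /\ Forall (fun p => 0 <= fst p + t * snd p) L /\
    Exists (fun p => fst p + t * snd p = 0) L.
Proof.
induction L as [|[l d] L IH]; intros HL HE; [inversion HE|].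
inversion HL as [|? ? Hl HL']; subst; simpl in Hl.
assert (Hd0 : d < 0 -> 0 < l / - d) by (intros; apply Rdiv_lt_0_compat; lra).
assert (Hdz : d < 0 -> l + l / - d * d = 0) by (intros; field; lra).
destruct (Exists_dec (fun p : R * R => snd p < 0) L) as [HE'|HN].
{ intros p; destruct (Rlt_dec (snd p) 0); auto. }
- destruct (IH HL' HE') as [t [Ht [Hpos Hzero]]].
  destruct (Rle_lt_dec 0 (l + t * d)) as [H|H].
  + exists t; split; auto.
  + assert (Hd : d < 0) by nra.
    specialize (Hd0 Hd); specialize (Hdz Hd).
    exists (l / - d); split; auto; split; [|left; auto].
    constructor; [simpl; lra|].
    rewrite Forall_forall in HL', Hpos |- *; intros p Hp.
    specialize (HL' p Hp); specialize (Hpos p Hp); simpl in HL', Hpos.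
    assert (l / - d < t) by nra.
    destruct (Rle_lt_dec 0 (snd p)); nra.
- assert (Hd : d < 0) by (inversion HE; subst; auto; contradiction).
  exists (l / - d); split; auto; split; [|left; auto].
  constructor; [simpl; rewrite Hdz; lra|].
  rewrite Forall_forall in HL' |- *; intros p Hp; specialize (HL' p Hp); simpl in HL'.
  destruct (Rle_lt_dec 0 (snd p)).
  + specialize (Hd0 Hd); nra.
  + elim HN; apply Exists_exists; exists p; auto.
Qed.

Section Decomposition.
Variable Q : Cx -> R.
Hypothesis HQ : forall th, Theta_hat th -> 0 <= lsum Q th.

Lemma antipodal_nonneg (a : Cx) : onT a -> 0 <= Q a + Q (- a)%cx.
Proof.
intros Ha; generalize (HQ _ (or_introl (ex_intro _ a (conj Ha eq_refl)))); simpl; lra.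
Qed.

Lemma triangle_nonneg (d1 d2 d3 : R) (w1 w2 w3 : Cx) : onT w1 -> onT w2 -> onT w3 ->
  w1 <> w2 -> w1 <> w3 -> w2 <> w3 -> 0 < d1 -> 0 < d2 -> 0 < d3 ->
  d1 * Cre w1 + d2 * Cre w2 + d3 * Cre w3 = 0 -> d1 * Cim w1 + d2 * Cim w2 + d3 * Cim w3 = 0 ->
  0 <= d1 * Q w1 + d2 * Q w2 + d3 * Q w3.
Proof.
intros W1 W2 W3 N1 N2 N3 D1 D2 D3 E1 E2.
set (s := d1 + d2 + d3); assert (Hs : 0 < s) by (unfold s; lra).
generalize (HQ ((d1 / s, w1) :: (d2 / s, w2) :: (d3 / s, w3) :: nil)); intros H.
replace (d1 * Q w1 + d2 * Q w2 + d3 * Q w3)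
  with (s * lsum Q ((d1 / s, w1) :: (d2 / s, w2) :: (d3 / s, w3) :: nil)) by (simpl; field; lra).
apply Rmult_le_pos; [lra|apply H].
right; exists (d1 / s), (d2 / s), (d3 / s), w1, w2, w3; repeat split; auto;
  try (apply Rdiv_lt_0_compat; auto).
- replace (d1 / s + d2 / s + d3 / s) with (s / s) by (unfold s; field; fold s; lra).
  field; lra.
- apply Cx_eq; cx_unfold.
  + replace (_ + _ + _) with ((d1 * Cre w1 + d2 * Cre w2 + d3 * Cre w3) / s) by (field; lra).
    rewrite E1; field; lra.
  + replace (_ + _ + _) with ((d1 * Cim w1 + d2 * Cim w2 + d3 * Cim w3) / s) by (field; lra).
    rewrite E2; field; lra.
Qed.

Section Step.
Variable n : nat.
Hypothesis IH : forall L, (length L <= n)%nat -> balanced L -> 0 <= lsum Q L.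

(** Equal atoms are merged. From antipodal ones a multiple of a measure of the first kind, with the
    smaller weight on both atoms, is split off; one atom with the difference remains. *)
Lemma lsum_nonneg_parallel (l1 l2 : R) (w1 w2 : Cx) (rest : list (R * Cx)) :
  (length rest < n)%nat -> cross w1 w2 = 0 ->
  balanced ((l1, w1) :: (l2, w2) :: rest) -> 0 <= lsum Q ((l1, w1) :: (l2, w2) :: rest).
Proof.
intros Hn C [F [E1 E2]].
inversion F as [|? ? [L1 W1] F']; inversion F' as [|? ? [L2 W2] F'']; subst; simpl in *.
destruct (cross_eq0 _ _ W1 W2 C) as [->| ->].
- assert (B : balanced ((l1 + l2, w1) :: rest)).
  { split; [constructor; auto; simpl; split; auto; lra|simpl; split; lra]. }
  apply IH in B; simpl in *; [lra|lia].
- generalize (antipodal_nonneg _ W1); intros A; simpl in E1, E2.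
  destruct (Rle_lt_dec l1 l2) as [Hl|Hl].
  + assert (B : balanced ((l2 - l1, (- w1)%cx) :: rest)).
    { split; [constructor; auto; simpl; split; auto; lra|simpl; split; lra]. }
    apply IH in B; simpl in *; [nra|lia].
  + assert (B : balanced ((l1 - l2, w1) :: rest)).
    { split; [constructor; auto; simpl; split; auto; lra|simpl; split; lra]. }
    apply IH in B; simpl in *; [nra|lia].
Qed.

Lemma lsum_nonneg_null (l1 l2 l3 : R) (w1 w2 w3 : Cx) (rest : list (R * Cx)) :
  (S (length rest) < n)%nat -> l1 = 0 \/ l2 = 0 \/ l3 = 0 ->
  balanced ((l1, w1) :: (l2, w2) :: (l3, w3) :: rest) ->
  0 <= lsum Q ((l1, w1) :: (l2, w2) :: (l3, w3) :: rest).
Proof.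
intros Hn H0 [F [E1 E2]].
inversion F as [|? ? P1 F']; inversion F' as [|? ? P2 F'']; inversion F'' as [|? ? P3 F3]; subst.
simpl in E1, E2; destruct H0 as [->|[->| ->]].
- assert (B : balanced ((l2, w2) :: (l3, w3) :: rest)).
  { split; [auto|simpl; split; lra]. }
  apply IH in B; simpl in *; [lra|lia].
- assert (B : balanced ((l1, w1) :: (l3, w3) :: rest)).
  { split; [auto|simpl; split; lra]. }
  apply IH in B; simpl in *; [lra|lia].
- assert (B : balanced ((l1, w1) :: (l2, w2) :: rest)).
  { split; [auto|simpl; split; lra]. }
  apply IH in B; simpl in *; [lra|lia].
Qed.

(* Moving the first three weights along a linear dependency of the three atoms kills one of them. *)
Lemma lsum_nonneg_move (l1 l2 l3 d1 d2 d3 : R) (w1 w2 w3 : Cx) (rest : list (R * Cx)) :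
  (S (length rest) < n)%nat -> 0 < l1 -> 0 < l2 -> 0 < l3 ->
  d1 < 0 \/ d2 < 0 \/ d3 < 0 ->
  d1 * Cre w1 + d2 * Cre w2 + d3 * Cre w3 = 0 -> d1 * Cim w1 + d2 * Cim w2 + d3 * Cim w3 = 0 ->
  balanced ((l1, w1) :: (l2, w2) :: (l3, w3) :: rest) ->
  exists t, 0 < t /\ 0 <= lsum Q ((l1, w1) :: (l2, w2) :: (l3, w3) :: rest)
                         + t * (d1 * Q w1 + d2 * Q w2 + d3 * Q w3).
Proof.
intros Hn L1 L2 L3 Hd D1 D2 [F [E1 E2]].
destruct (first_exit ((l1, d1) :: (l2, d2) :: (l3, d3) :: nil)) as [t [Ht [HF HE]]].
- repeat constructor; auto.
- destruct Hd as [H|[H|H]]; [left|right; left|right; right; left]; auto.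
- exists t; split; auto.
  inversion HF as [|? ? T1 HF1]; inversion HF1 as [|? ? T2 HF2]; inversion HF2 as [|? ? T3 HF3]; subst.
  inversion F as [|? ? P1 F']; inversion F' as [|? ? P2 F'']; inversion F'' as [|? ? P3 F3]; subst.
  simpl in *.
  assert (B : balanced ((l1 + t * d1, w1) :: (l2 + t * d2, w2) :: (l3 + t * d3, w3) :: rest)).
  { split; [repeat apply Forall_cons; simpl; tauto|simpl; split].
    - replace (_ + _) with (l1 * Cre w1 + (l2 * Cre w2 + (l3 * Cre w3 + lsum Cre rest))
        + t * (d1 * Cre w1 + d2 * Cre w2 + d3 * Cre w3)) by ring.
      rewrite E1, D1; ring.
    - replace (_ + _) with (l1 * Cim w1 + (l2 * Cim w2 + (l3 * Cim w3 + lsum Cim rest))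
        + t * (d1 * Cim w1 + d2 * Cim w2 + d3 * Cim w3)) by ring.
      rewrite E2, D2; ring. }
  apply lsum_nonneg_null in B; auto.
  + simpl in B; lra.
  + inversion HE as [? ? X|? ? X]; subst; [left; auto|].
    inversion X as [? ? Y|? ? Y]; subst; [right; left; auto|].
    inversion Y as [? ? Z|? ? Z]; subst; [right; right; auto|inversion Z].
Qed.

End Step.

(** Induction on the number of atoms. Three pairwise independent atoms have a linear dependency d
    with nonzero coefficients. If d has both signs, moving along d and along -d each kills an atom;
    the sum is affine along this line and nonnegative at both ends, hence nonnegative in between. If
    d has one sign, it is up to scale a measure of the second kind, so [Q] is nonnegative on it and
    a single move suffices. *)
Lemma lsum_nonneg_balanced (L : list (R * Cx)) : balanced L -> 0 <= lsum Q L.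
Proof.
enough (H : forall n L, (length L <= n)%nat -> balanced L -> 0 <= lsum Q L) by (apply (H (length L)); auto).
clear L; induction n as [|n IH]; intros L HL.
{ destruct L; simpl in *; [lra|lia]. }
destruct L as [|[l1 w1] [|[l2 w2] [|[l3 w3] rest]]]; intros B.
- simpl; lra.
- destruct B as [F [E1 E2]]; inversion F as [|? ? [L1 W1] _]; subst; simpl in *.
  apply onT_re_im in W1.
  assert (l1 = 0).
  { replace l1 with (l1 * (Cre w1 * Cre w1 + Cim w1 * Cim w1)) by (rewrite W1; ring).
    replace (l1 * _) with ((l1 * Cre w1 + 0) * Cre w1 + (l1 * Cim w1 + 0) * Cim w1) by ring.
    rewrite E1, E2; ring. }
  subst; lra.
- destruct (Req_dec (cross w1 w2) 0) as [C|C].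
  { apply (lsum_nonneg_parallel n IH) in B; auto; simpl in *; lia. }
  destruct B as [F [E1 E2]]; simpl in *; unfold cross in C.
  assert (l1 * (Cre w1 * Cim w2 - Cim w1 * Cre w2) = 0).
  { replace (l1 * _) with ((l1 * Cre w1 + (l2 * Cre w2 + 0)) * Cim w2
      - (l1 * Cim w1 + (l2 * Cim w2 + 0)) * Cre w2) by ring.
    rewrite E1, E2; ring. }
  assert (l2 * (Cre w1 * Cim w2 - Cim w1 * Cre w2) = 0).
  { replace (l2 * _) with ((l1 * Cim w1 + (l2 * Cim w2 + 0)) * Cre w1
      - (l1 * Cre w1 + (l2 * Cre w2 + 0)) * Cim w1) by ring.
    rewrite E1, E2; ring. }
  assert (l1 = 0) by (destruct (Rmult_integral _ _ H); auto; contradiction).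
  assert (l2 = 0) by (destruct (Rmult_integral _ _ H0); auto; contradiction).
  subst; lra.
- assert (Hn : (S (length rest) < n)%nat) by (simpl in HL; lia).
  destruct (Req_dec (cross w1 w2) 0) as [C3|C3].
  { apply (lsum_nonneg_parallel n IH); auto; simpl; lia. }
  destruct (Req_dec (cross w1 w3) 0) as [C2|C2].
  { replace (lsum Q _) with (lsum Q ((l1, w1) :: (l3, w3) :: (l2, w2) :: rest)) by (simpl; ring).
    apply (lsum_nonneg_parallel n IH); auto.
    destruct B as [F [E1 E2]]; simpl in *.
    inversion F as [|? ? P1 F']; inversion F' as [|? ? P2 F'']; inversion F'' as [|? ? P3 F3]; subst.
    split; [repeat apply Forall_cons; simpl; tauto|simpl; split; lra]. }
  destruct (Req_dec (cross w2 w3) 0) as [C1|C1].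
  { replace (lsum Q _) with (lsum Q ((l2, w2) :: (l3, w3) :: (l1, w1) :: rest)) by (simpl; ring).
    apply (lsum_nonneg_parallel n IH); auto.
    destruct B as [F [E1 E2]]; simpl in *.
    inversion F as [|? ? P1 F']; inversion F' as [|? ? P2 F'']; inversion F'' as [|? ? P3 F3]; subst.
    split; [repeat apply Forall_cons; simpl; tauto|simpl; split; lra]. }
  destruct B as [F E] eqn:HB; clear HB.
  inversion F as [|? ? [P1 W1] F']; inversion F' as [|? ? [P2 W2] F'']; inversion F'' as [|? ? [P3 W3] F3].
  simpl in P1, P2, P3, W1, W2, W3; subst.
  destruct P1 as [P1|P1]; [|apply (lsum_nonneg_null n IH); auto].
  destruct P2 as [P2|P2]; [|apply (lsum_nonneg_null n IH); auto].
  destruct P3 as [P3|P3]; [|apply (lsum_nonneg_null n IH); auto].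
  assert (N12 : w1 <> w2) by (intros ->; apply C3; unfold cross; ring).
  assert (N13 : w1 <> w3) by (intros ->; apply C2; unfold cross; ring).
  assert (N23 : w2 <> w3) by (intros ->; apply C1; unfold cross; ring).
  (* Cramer's rule: the 2 by 2 minors give the dependency of three vectors in the plane. *)
  set (d1 := cross w2 w3) in *; set (d2 := - cross w1 w3); set (d3 := cross w1 w2) in *.
  assert (D1 : d1 * Cre w1 + d2 * Cre w2 + d3 * Cre w3 = 0) by (unfold d1, d2, d3, cross; ring).
  assert (D2 : d1 * Cim w1 + d2 * Cim w2 + d3 * Cim w3 = 0) by (unfold d1, d2, d3, cross; ring).
  assert (D2' : d2 <> 0) by (unfold d2; lra).
  assert (Move := fun d1 d2 d3 H A1 A2 =>
    lsum_nonneg_move n IH l1 l2 l3 d1 d2 d3 w1 w2 w3 rest Hn P1 P2 P3 H A1 A2 B).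
  assert (Down : - d1 < 0 \/ - d2 < 0 \/ - d3 < 0 -> exists t, 0 < t /\
    0 <= lsum Q ((l1, w1) :: (l2, w2) :: (l3, w3) :: rest) - t * (d1 * Q w1 + d2 * Q w2 + d3 * Q w3)).
  { intros H; destruct (Move (- d1) (- d2) (- d3)) as [t [Ht K]]; auto; [lra|lra|].
    exists t; split; auto; lra. }
  assert (Up := fun H => Move d1 d2 d3 H D1 D2); clear Move.
  set (S0 := lsum Q _) in *; set (q := d1 * Q w1 + d2 * Q w2 + d3 * Q w3) in *.
  destruct (Rlt_dec 0 d1), (Rlt_dec 0 d2), (Rlt_dec 0 d3).
  1: { destruct Down as [t [Ht K]]; [lra|].
       assert (0 <= q) by (apply triangle_nonneg; auto); nra. }
  (* With the all-positive case closed, the seventh goal is the one with no positive coefficient;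
     all three are negative, since none is 0. *)
  7: { destruct Up as [t [Ht K]]; [lra|].
       assert (0 <= - d1 * Q w1 + - d2 * Q w2 + - d3 * Q w3) by (apply triangle_nonneg; auto; lra).
       unfold q in K; nra. }
  all: destruct Down as [t [Ht K]]; [lra|]; destruct Up as [t' [Ht' K']]; [lra|];
    destruct (Rle_lt_dec 0 q); nra.
Qed.

End Decomposition.

(** The list does not depend on [f]: one finite measure computes the sums for [Q] and for both
    components of the moment simultaneously. *)
Lemma Riemann_sum_weighted (ptd : SF_seq) : pointed_subdiv ptd ->
  exists L : list (R * R), Forall (fun p => 0 <= fst p) L /\
    forall f : R -> R, Riemann_sum f ptd = fold_right (fun p s => fst p * f (snd p) + s) 0 L.
Proof.
induction ptd as [x0|[a y] s IH] using SF_cons_ind; intros H.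
- exists nil; split; auto.
- destruct (IH (ptd_cons _ _ H)) as [L [HL E]].
  assert (Hh : a <= y <= SF_h s) by (apply (H 0%nat); rewrite SF_size_cons; apply Nat.lt_0_succ).
  exists ((SF_h s - a, y) :: L); split; [constructor; auto; simpl; lra|].
  intros f; rewrite Riemann_sum_cons, E; reflexivity.
Qed.

(* The Riemann sums of the measure are made balanced by one extra atom of small mass. *)
Lemma RInt_nonneg_balanced (Q : Cx -> R) (B : R) (u : R -> R) (I : R) :
  (forall th, Theta_hat th -> 0 <= lsum Q th) -> (forall w, onT w -> Rabs (Q w) <= B) ->
  (forall t, 0 <= u t) ->
  is_RInt (fun t => u t * Q (cis t)) 0 (2 * PI) I ->
  is_RInt (fun t => u t * cos t) 0 (2 * PI) 0 -> is_RInt (fun t => u t * sin t) 0 (2 * PI) 0 ->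
  0 <= I.
Proof.
intros HQ HB Hu I1 I2 I3; generalize PI_RGT_0; intros Hpi.
destruct (Rle_lt_dec 0 I) as [H|H]; auto; exfalso.
assert (B0 : 0 <= B) by (generalize (HB _ (cis_onT 0)) (Rabs_pos (Q (cis 0))); lra).
(* The Riemann sum is below [I + eps] and the correcting atom, of mass under [2 * eps], adds at most
   [2 * eps * B]. With this [eps] the total would be negative. *)
assert (He : 0 < - I / (1 + 2 * B)) by (apply Rdiv_lt_0_compat; lra).
set (eps := - I / (1 + 2 * B)) in *.
assert (Es : sign (2 * PI - 0) = 1) by (apply sign_eq_1; lra).
assert (close : forall f l, is_RInt f 0 (2 * PI) l ->
  Riemann_fine 0 (2 * PI) (fun ptd => Rabs (Riemann_sum f ptd - l) < eps)).
{ intros f l Hf.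
  generalize (proj1 (filterlim_locally _ _) Hf (mkposreal _ He)).
  apply filter_imp; intros ptd K; rewrite Es in K.
  assert (E : scal 1 (Riemann_sum f ptd) = Riemann_sum f ptd) by apply Rmult_1_l.
  rewrite E in K; exact K. }
generalize (filter_and _ _ (close _ _ I1) (filter_and _ _ (close _ _ I2) (close _ _ I3))).
intros [d Hd].
assert (Hex : Riemann_fine 0 (2 * PI) (fun ptd => pointed_subdiv ptd /\
  Rabs (Riemann_sum (fun t => u t * Q (cis t)) ptd - I) < eps /\
  Rabs (Riemann_sum (fun t => u t * cos t) ptd - 0) < eps /\
  Rabs (Riemann_sum (fun t => u t * sin t) ptd - 0) < eps)).
{ exists d; intros ptd Hp Hs; split; [apply Hs|apply Hd; auto]. }
apply filter_ex in Hex; destruct Hex as [ptd [Hp [S1 [S2 S3]]]].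
destruct (Riemann_sum_weighted ptd Hp) as [L [HL E]].
set (A := map (fun p : R * R => (fst p * u (snd p), cis (snd p))) L).
assert (EA : forall q, Riemann_sum (fun t => u t * q (cis t)) ptd = lsum q A).
{ intros q; rewrite E; unfold A; clear; induction L as [|p L IH]; simpl; auto.
  rewrite IH; ring. }
assert (FA : Forall (fun p => 0 <= fst p /\ onT (snd p)) A).
{ unfold A; clear - HL Hu; induction HL; simpl; constructor; auto; simpl; split.
  - apply Rmult_le_pos; auto.
  - apply cis_onT. }
generalize (EA Cre) (EA Cim); simpl; intros EAc EAs.
rewrite (EA Q) in S1; rewrite EAc, Rminus_0_r in S2; rewrite EAs, Rminus_0_r in S3.
set (m := mkC (lsum Cre A) (lsum Cim A)).
assert (Hm : Cnorm m < 2 * eps).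
{ eapply Rle_lt_trans; [apply Cnorm_le_re_im|]; simpl; lra. }
assert (Heps : eps * (1 + 2 * B) = - I) by (unfold eps; field; lra).
apply Rabs_lt_between in S1.
destruct (Req_dec (Cnorm m) 0) as [Z|Z].
- apply Cnorm_eq0 in Z.
  assert (Bal : balanced A).
  { split; auto; split; [apply (f_equal Cre) in Z|apply (f_equal Cim) in Z]; exact Z. }
  apply (lsum_nonneg_balanced Q HQ) in Bal; nra.
- generalize (Cnorm_ge0 m); intros Hm0.
  set (w := (- (RtoC (/ Cnorm m) * m))%cx).
  assert (Hw : onT w).
  { unfold onT, w; rewrite Cnorm_opp, Cnorm_mul, Cnorm_RtoC, Rabs_pos_eq.
    - field; auto.
    - left; apply Rinv_0_lt_compat; lra. }
  assert (Bal : balanced ((Cnorm m, w) :: A)).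
  { split; [constructor; auto|simpl; split].
    - replace (lsum Cre A) with (Cre m) by auto; field; auto.
    - replace (lsum Cim A) with (Cim m) by auto; field; auto. }
  apply (lsum_nonneg_balanced Q HQ) in Bal; simpl in Bal.
  generalize (HB w Hw); intros Hb; apply Rabs_le_between in Hb; nra.
Qed.

(** * Positive semidefinite kernels *)

Definition form (n : nat) (x c : nat -> Cx) (k : Cx -> Cx -> Cx) : Cx :=
  csum n (fun i => csum n (fun j => (c i * (c j)^* * k (x i) (x j))%cx)).

Lemma csum_ext (n : nat) (f g : nat -> Cx) :
  (forall i, (i < n)%nat -> f i = g i) -> csum n f = csum n g.
Proof.
induction n; simpl; intros H; auto.
rewrite IHn, H by auto; auto.
Qed.

Lemma csum_add (n : nat) (f g : nat -> Cx) :
  csum n (fun i => f i + g i)%cx = (csum n f + csum n g)%cx.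
Proof. induction n; simpl; [|rewrite IHn]; ring. Qed.

Lemma csum_mul_l (n : nat) (a : Cx) (f : nat -> Cx) :
  csum n (fun i => a * f i)%cx = (a * csum n f)%cx.
Proof. induction n; simpl; [|rewrite IHn]; ring. Qed.

Lemma csum_conj (n : nat) (f : nat -> Cx) : ((csum n f)^*)%cx = csum n (fun i => (f i)^*)%cx.
Proof. induction n; simpl; [apply Cconj_0|rewrite Cconj_add, IHn; auto]. Qed.

Lemma clim_csum {T : Type} {F : (T -> Prop) -> Prop} {FF : Filter F}
    (n : nat) (f : T -> nat -> Cx) (l : nat -> Cx) :
  (forall i, (i < n)%nat -> clim F (fun t => f t i) (l i)) ->
  clim F (fun t => csum n (f t)) (csum n l).
Proof.
induction n; simpl; intros H; [apply clim_const|].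
apply clim_add; auto.
Qed.

Section Form.
Variables (n : nat) (x c : nat -> Cx).
Hypothesis Hx : forall i, (i < n)%nat -> inD (x i).

Lemma form_ext (k k' : Cx -> Cx -> Cx) :
  (forall y z, inD y -> inD z -> k y z = k' y z) -> form n x c k = form n x c k'.
Proof.
intros H; apply csum_ext; intros i Hi; apply csum_ext; intros j Hj; rewrite H; auto.
Qed.

Lemma form_add (k k' : Cx -> Cx -> Cx) :
  form n x c (fun y z => k y z + k' y z)%cx = (form n x c k + form n x c k')%cx.
Proof.
unfold form; rewrite <- csum_add; apply csum_ext; intros i _.
rewrite <- csum_add; apply csum_ext; intros j _; ring.
Qed.

Lemma form_scal (a : Cx) (k : Cx -> Cx -> Cx) :
  form n x c (fun y z => a * k y z)%cx = (a * form n x c k)%cx.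
Proof.
unfold form; rewrite <- csum_mul_l; apply csum_ext; intros i _.
rewrite <- csum_mul_l; apply csum_ext; intros j _; ring.
Qed.

Lemma form_weight (p : Cx -> Cx) (k : Cx -> Cx -> Cx) :
  form n x c (fun y z => p y * (p z)^* * k y z)%cx = form n x (fun i => c i * p (x i))%cx k.
Proof.
apply csum_ext; intros i _; apply csum_ext; intros j _; rewrite Cconj_mul; ring.
Qed.

Lemma form_rank1 (p : Cx -> Cx) :
  form n x c (fun y z => p y * (p z)^*)%cx
  = RtoC (Cnorm2 (csum n (fun i => c i * p (x i))%cx)).
Proof.
rewrite <- Cnorm_sqr, <- Cnorm_sqr_conj, csum_conj.
set (s := csum n (fun i => (c i * p (x i))^*)%cx).
replace (csum n (fun i => c i * p (x i))%cx * s)%cx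
  with (s * csum n (fun i => c i * p (x i)))%cx by ring.
rewrite <- csum_mul_l; apply csum_ext; intros i _.
replace (s * (c i * p (x i)))%cx with (c i * p (x i) * s)%cx by ring.
unfold s; rewrite <- csum_mul_l; apply csum_ext; intros j _; rewrite Cconj_mul; ring.
Qed.

Lemma clim_form {T : Type} {F : (T -> Prop) -> Prop} {FF : Filter F}
    (K : T -> Cx -> Cx -> Cx) (k : Cx -> Cx -> Cx) :
  (forall y z, inD y -> inD z -> clim F (fun t => K t y z) (k y z)) ->
  clim F (fun t => form n x c (K t)) (form n x c k).
Proof.
intros H; apply clim_csum; intros i Hi; apply clim_csum; intros j Hj.
apply clim_mul; [apply clim_const|auto].
Qed.

Lemma form_bounded {T : Type} (P : T -> Prop) (K : T -> Cx -> Cx -> Cx) :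
  (forall y z, inD y -> inD z -> exists B, forall t, P t -> Cnorm (K t y z) <= B) ->
  exists B, forall t, P t -> Cnorm (form n x c (K t)) <= B.
Proof.
intros H.
assert (S : forall (m : nat) (f : T -> nat -> Cx),
  (forall i, (i < m)%nat -> exists B, forall t, P t -> Cnorm (f t i) <= B) ->
  exists B, forall t, P t -> Cnorm (csum m (f t)) <= B).
{ induction m; simpl; intros f Hf; [exists 0; intros; rewrite Cnorm0; lra|].
  destruct (IHm f) as [B HB]; [auto|]; destruct (Hf m) as [B' HB']; [lia|].
  exists (B + B'); intros t Pt; eapply Rle_trans; [apply Cnorm_triangle|].
  apply Rplus_le_compat; auto. }
apply (S n (fun t i => csum n (fun j => c i * (c j)^* * K t (x i) (x j))%cx)); intros i Hi.
apply (S n (fun t j => c i * (c j)^* * K t (x i) (x j))%cx); intros j Hj.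
destruct (H (x i) (x j)) as [B HB]; auto.
exists (Cnorm (c i * (c j)^*) * B); intros t Pt; rewrite Cnorm_mul.
apply Rmult_le_compat_l; [apply Cnorm_ge0|auto].
Qed.

(** The free factor [e] encodes a complex integral by real ones and absorbs the coefficients
    [c i * (c j)^*] of the form. *)
Lemma is_RInt_form (K : R -> Cx -> Cx -> Cx) (k : Cx -> Cx -> Cx) (a b : R) :
  (forall y z e, inD y -> inD z ->
     is_RInt (fun t => Cre (e * K t y z)) a b (Cre (e * k y z))) ->
  forall e, is_RInt (fun t => Cre (e * form n x c (K t))) a b (Cre (e * form n x c k)).
Proof.
intros H.
assert (S : forall (m : nat) (f : R -> nat -> Cx) (l : nat -> Cx),
  (forall i e, (i < m)%nat -> is_RInt (fun t => Cre (e * f t i)) a b (Cre (e * l i))) ->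
  forall e, is_RInt (fun t => Cre (e * csum m (f t))) a b (Cre (e * csum m l))).
{ induction m; simpl; intros f l Hf e.
  - eapply is_RInt_congr; [apply (is_RInt_const a b (0 : R))| |].
    + intros t; cx_unfold; ring.
    + unfold scal; simpl; unfold mult; simpl; cx_unfold; ring.
  - eapply is_RInt_congr; [exact (is_RInt_plus _ _ _ _ _ _ (IHm f l (fun i e Hi => Hf i e ltac:(lia)) e)
      (Hf m e ltac:(lia)))| |]; intros; unfold plus; cx_unfold; ring. }
apply (S n (fun t i => csum n (fun j => c i * (c j)^* * K t (x i) (x j))%cx)); intros i e Hi.
apply (S n (fun t j => c i * (c j)^* * K t (x i) (x j))%cx); intros j e' Hj.
eapply is_RInt_congr; [apply (H (x i) (x j) (e' * (c i * (c j)^*))%cx); auto| |]; intros; cbv beta; apply (f_equal Cre); ring.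
Qed.

End Form.

Lemma psd_ext (k k' : Cx -> Cx -> Cx) :
  (forall y z, inD y -> inD z -> k y z = k' y z) -> psd_kernel k -> psd_kernel k'.
Proof.
intros E H n x c Hx; change (Cim (form n x c k') = 0 /\ 0 <= Cre (form n x c k')).
rewrite <- (form_ext n x c Hx k k') by auto; apply (H n x c Hx).
Qed.

Lemma psd_add (k k' : Cx -> Cx -> Cx) :
  psd_kernel k -> psd_kernel k' -> psd_kernel (fun y z => k y z + k' y z)%cx.
Proof.
intros H H' n x c Hx; cbv zeta; fold (form n x c (fun y z => k y z + k' y z)%cx).
rewrite form_add; destruct (H n x c Hx), (H' n x c Hx).
fold (form n x c k) in *; fold (form n x c k') in *; cx_unfold; lra.
Qed.

Lemma psd_scal (a : R) (k : Cx -> Cx -> Cx) :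
  0 <= a -> psd_kernel k -> psd_kernel (fun y z => RtoC a * k y z)%cx.
Proof.
intros Ha H n x c Hx; cbv zeta; fold (form n x c (fun y z => RtoC a * k y z)%cx).
rewrite form_scal; destruct (H n x c Hx) as [H1 H2].
fold (form n x c k) in *; cx_unfold; rewrite H1; split; [ring|nra].
Qed.

Lemma psd_weight (p : Cx -> Cx) (k : Cx -> Cx -> Cx) :
  psd_kernel k -> psd_kernel (fun y z => p y * (p z)^* * k y z)%cx.
Proof.
intros H n x c Hx; cbv zeta; fold (form n x c (fun y z => p y * (p z)^* * k y z)%cx).
rewrite form_weight; apply (H n x); auto.
Qed.

Lemma psd_rank1 (p : Cx -> Cx) : psd_kernel (fun y z => p y * (p z)^*)%cx.
Proof.
intros n x c Hx; cbv zeta; fold (form n x c (fun y z => p y * (p z)^*)%cx).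
rewrite form_rank1; simpl; split; [auto|apply Cnorm2_ge0].
Qed.

(** Pointwise limits suffice, since each form involves finitely many values of the kernel. *)
Lemma psd_lim {T : Type} {F : (T -> Prop) -> Prop} {FF : ProperFilter F}
    (K : T -> Cx -> Cx -> Cx) (k : Cx -> Cx -> Cx) :
  F (fun t => psd_kernel (K t)) ->
  (forall y z, inD y -> inD z -> clim F (fun t => K t y z) (k y z)) -> psd_kernel k.
Proof.
intros HK Hlim n x c Hx; cbv zeta; fold (form n x c k).
assert (L := clim_form n x c Hx K k Hlim).
assert (A : forall eps, 0 < eps -> Rabs (Cim (form n x c k)) < eps /\ - eps < Cre (form n x c k)).
{ intros eps He; destruct (filter_ex _ (filter_and _ _ HK (L eps He))) as [t [Ht Hn]].
  destruct (Ht n x c Hx) as [H1 H2]; fold (form n x c (K t)) in H1, H2.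
  generalize (Cre_le_norm (form n x c (K t) - form n x c k))
    (Cim_le_norm (form n x c (K t) - form n x c k)); simpl; rewrite H1; intros R1 R2.
  apply Rabs_le_between in R1, R2; split; [apply Rabs_def1|]; lra. }
split.
- apply cond_eq; intros eps He; rewrite Rminus_0_r; apply A; auto.
- apply Rnot_lt_le; intros H; destruct (A (- Cre (form n x c k))) as [_ H']; lra.
Qed.

(** * The test functions *)

Lemma Theta_hat_probability (th : list (R * Cx)) : Theta_hat th ->
  Forall (fun p => 0 < fst p /\ onT (snd p)) th /\
  lsum (fun _ => 1) th = 1 /\ lsum Cre th = 0 /\ lsum Cim th = 0.
Proof.
intros [[a [Ha ->]]|(l1 & l2 & l3 & w1 & w2 & w3 & -> & W1 & W2 & W3 & _ & _ & _ & L1 & L2 & L3 & S & M)].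
- split; [|simpl; lra].
  repeat apply Forall_cons; simpl; try split; auto; try lra.
  unfold onT in *; rewrite Cnorm_opp; auto.
- split; [|split; [simpl; lra|]].
  + repeat apply Forall_cons; simpl; auto.
  + generalize (f_equal Cre M) (f_equal Cim M); cx_unfold; lra.
Qed.

Lemma herglotz_kernel_re (w z : Cx) : onT w -> (w - z)%cx <> C0 ->
  Cre (herglotz_kernel w z) = (1 - Cnorm2 z) / Cnorm2 (w - z).
Proof.
intros Hw N; apply Cnorm2_gt0 in N; apply onT_re_im in Hw.
unfold herglotz_kernel, Cdiv, Cinv; revert N; rewrite <- Hw.
unfold Cnorm2; cx_unfold; intros N; field; lra.
Qed.

Lemma inD_norm2 (z : Cx) : inD z -> Cnorm2 z < 1.
Proof. unfold inD; rewrite <- Cnorm_sqr; generalize (Cnorm_ge0 z); nra. Qed.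

Lemma inD_RtoC (r : R) : 0 <= r < 1 -> inD (RtoC (- r)).
Proof. intros H; unfold inD; rewrite Cnorm_RtoC, Rabs_Ropp, Rabs_pos_eq; lra. Qed.

Lemma herglotz_kernel_re_ge0 (w z : Cx) : onT w -> inD z -> 0 <= Cre (herglotz_kernel w z).
Proof.
intros Hw Hz; generalize (onT_sub_neq0 _ _ Hw Hz); intros N.
rewrite herglotz_kernel_re by auto; apply Cnorm2_gt0 in N; apply inD_norm2 in Hz.
left; apply Rdiv_lt_0_compat; lra.
Qed.

Lemma Cneq0_of_re (z : Cx) : 0 < Cre z -> z <> C0.
Proof. intros H ->; simpl in H; lra. Qed.

Lemma h_theta_re_ge0 (th : list (R * Cx)) (z : Cx) :
  Forall (fun p => 0 < fst p /\ onT (snd p)) th -> inD z -> 0 <= Cre (h_theta th z).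
Proof.
intros Hth Hz; induction Hth as [|[l w] rest [Hl Hw] HF IH]; [simpl; lra|].
change (0 <= Cre (RtoC l * herglotz_kernel w z + h_theta rest z)).
rewrite Cre_add, Cre_scal; simpl in Hl, Hw.
generalize (herglotz_kernel_re_ge0 _ _ Hw Hz) IH; nra.
Qed.

Section TestFunction.
Variable th : list (R * Cx).
Hypothesis Hth : Forall (fun p => 0 < fst p /\ onT (snd p)) th.

Lemma h_theta_add1_neq0 (z : Cx) : inD z -> (h_theta th z + 1)%cx <> C0.
Proof.
intros Hz; apply Cneq0_of_re; generalize (h_theta_re_ge0 th z Hth Hz); cx_unfold; lra.
Qed.

Lemma psi_theta_norm_le1 (z : Cx) : inD z -> Cnorm (psi_theta th z) <= 1.
Proof.
intros Hz; generalize (h_theta_add1_neq0 z Hz) (h_theta_re_ge0 th z Hth Hz); intros N Hr.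
unfold psi_theta; rewrite Cnorm_div by auto; apply Cnorm_gt0 in N.
apply Rmult_le_reg_r with (Cnorm (h_theta th z + 1)); auto.
unfold Rdiv; rewrite Rmult_assoc, Rinv_l, Rmult_1_l, Rmult_1_r by lra.
apply Cnorm_le_of_sqr; [lra|]; rewrite Cnorm_sqr.
unfold Cnorm2; cx_unfold; lra.
Qed.

Lemma psi_theta_defect (x y : Cx) : inD x -> inD y ->
  (1 - psi_theta th x * (psi_theta th y)^*)%cx =
  (RtoC 2 * (h_theta th x + (h_theta th y)^*) / ((h_theta th x + 1) * (h_theta th y + 1)^*))%cx.
Proof.
intros Hx Hy; generalize (h_theta_add1_neq0 x Hx) (h_theta_add1_neq0 y Hy); intros N1 N2.
apply Cconj_neq0 in N2; unfold psi_theta; autorewrite with cconj in *.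
replace (RtoC 2) with (C1 + C1)%cx by cx_ring; field; auto.
Qed.

(* The boundary value is 1 if -1 is an atom (a pole of [h_theta]); otherwise
   [h_theta] is continuous at -1 and purely imaginary there. *)
Lemma psi_theta_boundary : exists c, Cnorm c = 1 /\ boundary_value_at_m1 (psi_theta th) c.
Proof.
set (m1 := RtoC (-1)).
assert (Hm1 : Cnorm2 m1 = 1) by (unfold m1, Cnorm2; simpl; ring).
destruct (Exists_dec (fun p : R * Cx => snd p = m1) th) as [HE|HN].
{ intros p; apply Cx_eq_dec. }
- assert (Hl : exists l, 0 < l /\ forall r, 0 < r < 1 -> l * / (1 - r) <= Cre (h_theta th (RtoC (- r)))).
  { induction Hth as [|[l w] rest [Hl Hw] HF IH]; [inversion HE|simpl in Hl, Hw].
    assert (E : forall z, h_theta ((l, w) :: rest) z = (RtoC l * herglotz_kernel w z + h_theta rest z)%cx)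
      by reflexivity.
    destruct (Exists_dec (fun p : R * Cx => snd p = m1) rest) as [HE'|HN'].
    { intros p; apply Cx_eq_dec. }
    - destruct (IH HF HE') as [l0 [H0 H1]]; exists l0; split; auto; intros r Hr.
      rewrite E, Cre_add, Cre_scal; specialize (H1 r Hr).
      generalize (herglotz_kernel_re_ge0 w (RtoC (- r)) Hw (inD_RtoC r ltac:(lra))); nra.
    - assert (w = m1) by (inversion HE; subst; auto; contradiction); subst w.
      exists l; split; auto; intros r Hr; rewrite E, Cre_add, Cre_scal.
      assert (R1 := h_theta_re_ge0 rest _ HF (inD_RtoC r ltac:(lra))).
      assert (R2 : Cre (herglotz_kernel m1 (RtoC (- r))) = (1 + r) * / (1 - r)).
      { rewrite herglotz_kernel_re by (auto; apply onT_sub_neq0; auto; apply inD_RtoC; lra).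
        unfold m1, Cnorm2; cx_unfold; field; nra. }
      rewrite R2; assert (I : 0 < / (1 - r)) by (apply Rinv_0_lt_compat; lra).
      assert (0 <= l * / (1 - r) * r) by (repeat apply Rmult_le_pos; lra); lra. }
  destruct Hl as [l [Hl Hre]]; exists C1; split; [apply Cnorm1|].
  (* The distance from psi to 1 is 2 over the modulus of h + 1, and Re h is at least
     [l / (1 - r)]. *)
  intros eps He; exists (eps * l / 2); split; [nra|]; intros r Hr Hr'.
  assert (Hz := inD_RtoC r ltac:(lra)); generalize (h_theta_add1_neq0 _ Hz); intros N.
  unfold psi_theta.
  replace ((h_theta th (RtoC (- r)) - 1) / (h_theta th (RtoC (- r)) + 1) - 1)%cx
    with (- RtoC 2 / (h_theta th (RtoC (- r)) + 1))%cx
    by (replace (RtoC 2) with (C1 + C1)%cx by cx_ring; field; auto).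
  rewrite Cnorm_div, Cnorm_opp, Cnorm_RtoC, Rabs_pos_eq by (auto; lra).
  specialize (Hre r Hr).
  generalize (Cre_le_norm (h_theta th (RtoC (- r)) + 1)); intros G.
  apply Rabs_le_between in G; simpl Cre in G.
  assert (I : 0 < / (1 - r)) by (apply Rinv_0_lt_compat; lra).
  assert (P : 0 < l * / (1 - r)) by nra.
  apply Rmult_lt_reg_r with (Cnorm (h_theta th (RtoC (- r)) + 1)); [lra|].
  unfold Rdiv; rewrite Rmult_assoc, Rinv_l by lra.
  apply Rlt_le_trans with (eps * (l * / (1 - r))); [|nra].
  apply Rmult_lt_reg_r with (1 - r); [lra|].
  replace (eps * (l * / (1 - r)) * (1 - r)) with (eps * l) by (field; lra); lra.
- assert (Hc : Cre (h_theta th m1) = 0 /\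
    clim (at_left 1) (fun r => h_theta th (RtoC (- r))) (h_theta th m1)).
  { induction Hth as [|[l w] rest [Hl Hw] HF IH]; [split; [auto|exact (clim_const (F := at_left 1) C0)]|simpl in Hl, Hw].
    destruct (IH HF) as [I1 I2]; [intros X; apply HN; right; auto|].
    assert (Nw : (w - m1)%cx <> C0) by (apply Csub_neq0; intros ->; apply HN; left; auto).
    split.
    - change (Cre (RtoC l * herglotz_kernel w m1 + h_theta rest m1) = 0).
      rewrite Cre_add, Cre_scal, herglotz_kernel_re, Hm1, I1 by auto; unfold Rdiv; ring.
    - assert (Hr : clim (at_left 1) (fun r => RtoC (- r)) m1).
      { intros eps He; apply (filter_le_within (F := locally 1)).
        generalize (clim_RtoC 1 eps He); apply filter_imp; intros r Hr.
        replace (RtoC (- r) - m1)%cx with (- (RtoC r - RtoC 1))%cx by (unfold m1; cx_ring).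
        rewrite Cnorm_opp; auto. }
      apply clim_add; auto; apply clim_mul; [apply clim_const|].
      apply clim_div; auto; [apply clim_add|apply clim_sub]; auto; apply clim_const. }
  destruct Hc as [Hre Hlim].
  assert (N : (h_theta th m1 + 1)%cx <> C0) by (apply Cneq0_of_re; simpl; rewrite Hre; lra).
  exists (psi_theta th m1); split.
  + unfold psi_theta; rewrite Cnorm_div by auto.
    replace (Cnorm (h_theta th m1 - 1)) with (Cnorm (h_theta th m1 + 1)).
    * apply Cnorm_gt0 in N; field; lra.
    * unfold Cnorm, Cnorm2; f_equal; cx_unfold; rewrite Hre; ring.
  + intros eps He.
    assert (L : clim (at_left 1) (fun r => psi_theta th (RtoC (- r))) (psi_theta th m1)).
    { apply clim_div; auto; [apply clim_sub|apply clim_add]; auto; apply clim_const. }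
    destruct (L eps He) as [d Hd]; exists d; split; [apply cond_pos|].
    intros r Hr Hrd; apply Hd; [|lra].
    change (Rabs (r - 1) < d); apply Rabs_def1; destruct d; simpl in *; lra.
Qed.

Lemma boundary_value_norm_le1 (c : Cx) : boundary_value_at_m1 (psi_theta th) c -> Cnorm c <= 1.
Proof.
intros H; apply le_epsilon; intros eps He; destruct (H eps He) as [d [Hd K]].
set (r := Rmax (1/2) (1 - d / 2)).
assert (1/2 <= r) by apply Rmax_l.
assert (1 - d / 2 <= r) by apply Rmax_r.
assert (r < 1) by (apply Rmax_lub_lt; lra).
specialize (K r ltac:(lra) ltac:(lra)); rewrite Cnorm_sub_sym in K.
generalize (Cnorm_triangle (c - psi_theta th (RtoC (- r))) (psi_theta th (RtoC (- r)))).
replace (c - psi_theta th (RtoC (- r)) + psi_theta th (RtoC (- r)))%cx with c by ring.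
generalize (psi_theta_norm_le1 _ (inD_RtoC r ltac:(lra))); lra.
Qed.

End TestFunction.

(** * Functions of [H^oo_1] are multipliers of all the kernels *)

(** Undoes the Cayley transform: weighting by [h_theta + 1] clears the denominators of
    [psi_theta_defect]. The normalising constant has modulus 1, hence drops out of psi times its
    conjugate. *)
Lemma psd_h_theta (k : Cx -> Cx -> Cx) (th : list (R * Cx)) : in_KPsi Psi_hat k -> Theta_hat th ->
  psd_kernel (fun x y => (h_theta th x + (h_theta th y)^*) * k x y)%cx.
Proof.
intros [_ Hk] Hth; destruct (Theta_hat_probability th Hth) as [Hpos _].
destruct (psi_theta_boundary th Hpos) as [c [Hc Hb]].
assert (P := Hk _ (ex_intro _ th (ex_intro _ c (conj Hth (conj Hb eq_refl))))).
apply (psd_weight (fun x => h_theta th x + 1)%cx), (psd_scal (1/2)) in P; [|lra].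
revert P; apply psd_ext; intros x y Hx Hy.
generalize (h_theta_add1_neq0 th Hpos x Hx) (h_theta_add1_neq0 th Hpos y Hy); intros N1 N2.
apply Cconj_neq0 in N2.
replace (1 - c^* * psi_theta th x * (c^* * psi_theta th y)^*)%cx
  with (1 - psi_theta th x * (psi_theta th y)^*)%cx.
- rewrite (psi_theta_defect th Hpos x y Hx Hy).
  replace (RtoC (1/2)) with (1 / RtoC 2)%cx by (unfold Cdiv, Cinv, Cnorm2; apply Cx_eq; cx_unfold; field).
  field; repeat split; auto; apply RtoC_neq0; lra.
- autorewrite with cconj.
  replace (c^* * psi_theta th x * (c * (psi_theta th y)^*))%cx
    with (c * c^* * (psi_theta th x * (psi_theta th y)^*))%cx by ring.
  rewrite Cnorm_sqr_conj, Hc, Rmult_1_r; fold C1; ring.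
Qed.

(** For fixed points and coefficients, the form of [K w] is a function of the atom [w]. Its sum
    against a measure of [Theta_hat] is the form of [h_theta], controlled by [psd_h_theta]; its
    integral against Re g is 2 pi times the form of [g]. [RInt_nonneg_balanced] carries positivity
    from the former to the latter. *)
Lemma psd_positive_real (k : Cx -> Cx -> Cx) (g : Cx -> Cx) : in_KPsi Psi_hat k ->
  (forall z, Cnorm z <= 1 -> exists l, cdiff g z l) -> (forall z, onT z -> 0 <= Cre (g z)) ->
  cdiff g C0 C0 -> psd_kernel (fun x y => (g x + (g y)^*) * k x y)%cx.
Proof.
intros Hk Dg Pg D0 n x c Hx; cbv zeta.
fold (form n x c (fun x y => (g x + (g y)^*) * k x y)%cx).
set (K := fun w y z => ((herglotz_kernel w y + (herglotz_kernel w z)^*) * k y z)%cx).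
set (G := form n x c (fun x y => (g x + (g y)^*) * k x y)%cx).
assert (HK : forall e th, lsum (fun w => Cre (e * form n x c (K w))) th =
  Cre (e * form n x c (fun y z => (h_theta th y + (h_theta th z)^*) * k y z)%cx)).
{ intros e th; induction th as [|[l w] th IH].
  - rewrite (form_ext n x c Hx _ (fun y z => C0 * C0)%cx).
    + rewrite form_scal; simpl; cx_unfold; ring.
    + intros; simpl; rewrite Cconj_0; ring.
  - cbn [lsum]; rewrite IH, (form_ext n x c Hx
      (fun y z => (h_theta ((l, w) :: th) y + (h_theta ((l, w) :: th) z)^*) * k y z)%cx
      (fun y z => RtoC l * K w y z + (h_theta th y + (h_theta th z)^*) * k y z)%cx).
    + rewrite form_add, (form_scal n x c (RtoC l) (K w)), <- Cre_scal, <- Cre_add; apply (f_equal Cre); ring.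
    + intros y z _ _; unfold K, herglotz_kernel; simpl; autorewrite with cconj; ring. }
destruct (form_bounded n x c Hx onT K) as [B HB].
{ intros y z Hy Hz.
  exists ((2 / (1 - Cnorm y) + 2 / (1 - Cnorm z)) * Cnorm (k y z)); intros w Hw.
  assert (HP : forall v, inD v -> Cnorm (herglotz_kernel w v) <= 2 / (1 - Cnorm v)).
  { intros v Hv; unfold herglotz_kernel; rewrite Cnorm_div by (apply onT_sub_neq0; auto).
    unfold inD, onT in *; generalize (Cnorm_sub_ge w v) (Cnorm_triangle w v) (Cnorm_ge0 v); intros.
    apply Rmult_le_compat; [apply Cnorm_ge0| |lra|apply Rinv_le_contravar; lra].
    left; apply Rinv_0_lt_compat; lra. }
  unfold K; rewrite Cnorm_mul; apply Rmult_le_compat_r; [apply Cnorm_ge0|].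
  eapply Rle_trans; [apply Cnorm_triangle|]; rewrite Cnorm_conj; apply Rplus_le_compat; auto. }
assert (Int : forall e, is_RInt (fun t => Cre (g (cis t)) * Cre (e * form n x c (K (cis t)))) 0 (2 * PI)
  (2 * PI * Cre (e * G))).
{ intros e.
  eapply is_RInt_congr.
  - apply (is_RInt_form n x c Hx (fun t y z => RtoC (Cre (g (cis t))) * K (cis t) y z)%cx
      (fun y z => RtoC (2 * PI) * ((g y + (g z)^*) * k y z))%cx 0 (2 * PI)) with (e := e).
    intros y z e' Hy Hz.
    (* The second representation is taken with the conjugate constant, so the two imaginary
       constants [Cim (g C0)] cancel in g(y) plus the conjugate of g(z). *)
    eapply is_RInt_congr; [exact (is_RInt_plus _ _ _ _ _ _ (herglotz g Dg y (e' * k y z)%cx Hy)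
      (herglotz g Dg z ((e' * k y z)^*)%cx Hz))| |]; intros; unfold plus, K; cx_unfold; ring.
  - intros t; cbv beta; rewrite form_scal, <- Cre_scal; apply (f_equal Cre); ring.
  - rewrite form_scal; fold G; rewrite <- Cre_scal; apply (f_equal Cre); ring. }
assert (Pos : forall e, (forall th, Theta_hat th ->
    0 <= Cre (e * form n x c (fun y z => (h_theta th y + (h_theta th z)^*) * k y z)%cx)) ->
  0 <= Cre (e * G)).
{ intros e He; generalize PI_RGT_0; intros Hpi.
  enough (0 <= 2 * PI * Cre (e * G)) by nra.
  apply RInt_nonneg_balanced with (Q := fun w => Cre (e * form n x c (K w))) (B := Cnorm e * B)
    (u := fun t => Cre (g (cis t))).
  - intros th Hth; rewrite HK; auto.
  - intros w Hw; eapply Rle_trans; [apply Cre_le_norm|]; rewrite Cnorm_mul.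
    apply Rmult_le_compat_l; [apply Cnorm_ge0|auto].
  - intros t; apply Pg, cis_onT.
  - apply Int.
  (* The constants [C1] and [- Ci] extract the cosine and the sine from [cis]. *)
  - eapply is_RInt_congr; [exact (herglotz_moment g Dg C1 D0)| |auto]; intros; cx_unfold; ring.
  - eapply is_RInt_congr; [exact (herglotz_moment g Dg (- Ci)%cx D0)| |auto]; intros; cx_unfold; ring. }
assert (Th : forall th, Theta_hat th ->
  let s := form n x c (fun y z => (h_theta th y + (h_theta th z)^*) * k y z)%cx in
  Cim s = 0 /\ 0 <= Cre s) by (intros th Hth; apply (psd_h_theta k th Hk Hth n x c Hx)).
(* [e = C1] gives nonnegativity; [Ci] and [- Ci] together force the imaginary part to vanish. *)
generalize (Pos C1) (Pos Ci) (Pos (- Ci)%cx); intros P1 P2 P3; split.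
- assert (0 <= Cre (Ci * G)).
  { apply P2; intros th Hth; destruct (Th th Hth) as [T1 T2]; cx_unfold; rewrite T1; lra. }
  assert (0 <= Cre (- Ci * G)).
  { apply P3; intros th Hth; destruct (Th th Hth) as [T1 T2]; cx_unfold; rewrite T1; lra. }
  cx_unfold; lra.
- assert (0 <= Cre (C1 * G)).
  { apply P1; intros th Hth; destruct (Th th Hth) as [T1 T2]; cx_unfold; lra. }
  cx_unfold; lra.
Qed.

(** The bound [r < 1] keeps [1 - f] away from 0, so that the Cayley transform [h] exists on the
    disc. Dilating by [rho] makes [h] differentiable up to the circle, and weighting by [1 - f] at
    the end returns from [h] to [f]. *)
Lemma contraction_in_ball (f : Cx -> Cx) (r : R) : holomorphic_on_D f -> has_cderiv_at f C0 C0 ->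
  r < 1 -> (forall z, inD z -> Cnorm (f z) <= r) -> in_ball_HinfK Psi_hat f.
Proof.
intros Hf H0 Hr Hb k Hk.
set (h := fun z => ((1 + f z) / (1 - f z))%cx).
assert (N : forall z, inD z -> (1 - f z)%cx <> C0).
{ intros z Hz; apply Cneq0_of_norm; generalize (Cnorm_sub_ge 1 (f z)) (Hb z Hz); rewrite Cnorm1; lra. }
assert (Dh : forall z l, inD z -> has_cderiv_at f z l -> exists l', cdiff h z l' /\ (l = C0 -> l' = C0)).
{ intros z l Hz Hl; apply has_cderiv_at_cdiff in Hl; auto; eexists; split.
  - apply cdiff_div; [apply N; auto|apply cdiff_add; [apply cdiff_const|exact Hl]|].
    apply cdiff_sub; [apply cdiff_const|exact Hl].
  - intros ->; unfold Cdiv; ring. }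
assert (D0 : inD C0) by (unfold inD; rewrite Cnorm0; lra).
assert (Psd : forall rho, 0 < rho < 1 ->
  psd_kernel (fun x y => (h (RtoC rho * x) + (h (RtoC rho * y))^*) * k x y)%cx).
{ intros rho Hrho.
  assert (Hin : forall z, Cnorm z <= 1 -> inD (RtoC rho * z)%cx).
  { intros z Hz; unfold inD; rewrite Cnorm_mul, Cnorm_RtoC, Rabs_pos_eq by lra.
    generalize (Cnorm_ge0 z); nra. }
  apply (psd_positive_real k (fun z => h (RtoC rho * z)%cx) Hk).
  - intros z Hz; destruct (Hf _ (Hin z Hz)) as [l Hl].
    destruct (Dh _ l (Hin z Hz) Hl) as [l' [Hl' _]]; eexists; apply cdiff_scaled, Hl'.
  - intros z Hz; assert (Hz' : inD (RtoC rho * z)%cx) by (apply Hin; rewrite Hz; lra).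
    set (v := (RtoC rho * z)%cx) in *; unfold h.
    generalize (N v Hz') (Hb v Hz'); intros Nv Bv; apply Cnorm2_gt0 in Nv.
    assert (E : Cre ((1 + f v) / (1 - f v)) = (1 - Cnorm2 (f v)) / Cnorm2 (1 - f v)).
    { unfold Cdiv, Cinv; revert Nv; unfold Cnorm2; cx_unfold; intros; field; lra. }
    rewrite E; left; apply Rdiv_lt_0_compat; auto.
    generalize (inD_norm2 (f v)); unfold inD; lra.
  - destruct (Dh C0 C0 D0 H0) as [l' [Hl' E]]; rewrite (E eq_refl) in Hl'.
    replace C0 with (C0 * RtoC rho)%cx at 2 by ring.
    apply cdiff_scaled; replace (RtoC rho * C0)%cx with C0 by ring; auto. }
assert (P : psd_kernel (fun x y => (h x + (h y)^*) * k x y)%cx).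
{ apply (psd_lim (F := at_left 1)
    (fun rho x y => (h (RtoC rho * x) + (h (RtoC rho * y))^*) * k x y)%cx).
  - exists (mkposreal 1 Rlt_0_1); intros rho Hrho Hrho1; apply Psd.
    change (Rabs (rho - 1) < 1) in Hrho; apply Rabs_lt_between in Hrho; lra.
  - assert (L : forall z, inD z -> clim (at_left 1) (fun rho => h (RtoC rho * z)%cx) (h z)).
    { intros z Hz; destruct (Hf z Hz) as [l Hl]; destruct (Dh z l Hz Hl) as [l' [Hl' _]].
      apply clim_comp; [apply (cdiff_cont _ _ _ Hl')|].
      enough (Lz : clim (at_left 1) (fun rho => RtoC rho * z)%cx (RtoC 1 * z)).
      { replace (RtoC 1 * z)%cx with z in Lz by (fold C1; ring); exact Lz. }
      apply clim_mul; [|apply clim_const].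
      intros eps He; apply (filter_le_within (F := locally 1)), (clim_RtoC 1 eps He). }
    intros y z Hy Hz; apply clim_mul; [|apply clim_const].
    apply clim_add; [|apply clim_conj]; auto. }
apply (psd_weight (fun z => 1 - f z)%cx), (psd_scal (1/2)) in P; [|lra].
revert P; apply psd_ext; intros x y Hx Hy.
generalize (N x Hx) (N y Hy); intros N1 N2; apply Cconj_neq0 in N2.
unfold h; autorewrite with cconj in *.
replace (RtoC (1/2)) with (1 / RtoC 2)%cx by (unfold Cdiv, Cinv, Cnorm2; apply Cx_eq; cx_unfold; field).
assert (RtoC 2 <> C0) by (apply RtoC_neq0; lra).
replace (RtoC 2) with (C1 + C1)%cx in * by cx_ring; field; auto.
Qed.

(** * The kernel of the subspace [f'(0) = 0] of the Hardy space *)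

Definition szego (x y : Cx) : Cx := Cinv (1 - x * y^*)%cx.

(** The sum of the powers of [x * y^*] with the exponent 1 left out. *)
Definition hardy1_kernel (x y : Cx) : Cx := (szego x y - x * y^*)%cx.

Fixpoint Cpow (z : Cx) (n : nat) : Cx :=
  match n with O => C1 | S m => (Cpow z m * z)%cx end.

Lemma Cnorm_pow (z : Cx) (n : nat) : Cnorm (Cpow z n) = Cnorm z ^ n.
Proof. induction n; simpl; [apply Cnorm1|rewrite Cnorm_mul, IHn; ring]. Qed.

Lemma szego_denom_neq0 (x y : Cx) : inD x -> inD y -> (1 - x * y^*)%cx <> C0.
Proof. unfold inD; intros; apply one_sub_mul_conj_neq0; lra. Qed.

Lemma psd_szego : psd_kernel szego.
Proof.
set (K := fun N x y => csum N (fun n => Cpow x n * (Cpow y n)^*)%cx).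
apply (psd_lim (F := eventually) K).
- apply filter_forall; induction x as [|n IH].
  + apply (psd_ext (fun _ _ => C0 * C0^*)%cx); [|apply psd_rank1].
    intros; unfold K; simpl; ring.
  + apply (psd_add (K n) (fun x y => Cpow x n * (Cpow y n)^*)%cx); auto; apply psd_rank1.
- intros x y Hx Hy; generalize (szego_denom_neq0 x y Hx Hy); intros N.
  set (q := (x * y^*)%cx) in *.
  assert (Hq : Cnorm q < 1).
  { unfold q; rewrite Cnorm_mul, Cnorm_conj; unfold inD in *.
    generalize (Cnorm_ge0 x) (Cnorm_ge0 y); nra. }
  assert (E : forall n, (K n x y - szego x y)%cx = (- Cpow q n / (1 - q))%cx).
  { intros n; unfold szego; fold q; induction n as [|n IH].
    - unfold K; simpl; field; auto.
    - assert (P : forall m, (Cpow x m * (Cpow y m)^*)%cx = Cpow q m).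
      { induction m as [|m IHm]; simpl; [rewrite Cconj_1; ring|].
        rewrite Cconj_mul, <- IHm; unfold q; ring. }
      change (K (S n) x y) with (K n x y + Cpow x n * (Cpow y n)^*)%cx.
      replace (K n x y + Cpow x n * (Cpow y n)^* - Cinv (1 - q))%cx
        with ((K n x y - Cinv (1 - q)) + Cpow x n * (Cpow y n)^*)%cx by ring.
      rewrite IH, P; simpl; field; auto. }
  intros eps He; generalize (Cnorm_gt0 _ N); intros N'.
  destruct (pow_lt_1_zero (Cnorm q)) with (y := eps * Cnorm (1 - q)) as [M HM].
  { rewrite Rabs_pos_eq; auto; apply Cnorm_ge0. }
  { nra. }
  exists M; intros n Hn; rewrite E, Cnorm_div, Cnorm_opp, Cnorm_pow by auto.
  specialize (HM n Hn); rewrite Rabs_pos_eq in HM by (apply pow_le, Cnorm_ge0).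
  apply Rmult_lt_reg_r with (Cnorm (1 - q)); auto.
  unfold Rdiv; rewrite Rmult_assoc, Rinv_l by lra; lra.
Qed.

Lemma hardy1_kernel_eq (x y : Cx) : inD x -> inD y ->
  hardy1_kernel x y = (1 + (x * x) * (y * y)^* * szego x y)%cx.
Proof.
intros Hx Hy; generalize (szego_denom_neq0 x y Hx Hy); intros N.
unfold hardy1_kernel, szego; rewrite Cconj_mul; field; auto.
Qed.

Lemma psd_hardy1_kernel : psd_kernel hardy1_kernel.
Proof.
apply (psd_ext (fun x y => 1 * 1^* + (x * x) * (y * y)^* * szego x y)%cx).
- intros x y Hx Hy; rewrite hardy1_kernel_eq, Cconj_1 by auto; ring.
- apply psd_add; [apply (psd_rank1 (fun _ => C1))|].
  apply (psd_weight (fun x => x * x)%cx), psd_szego.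
Qed.

Fixpoint clsum (f : Cx -> Cx) (L : list (R * Cx)) : Cx :=
  match L with
  | nil => C0
  | (l, w) :: rest => (RtoC l * f w + clsum f rest)%cx
  end.

Lemma clsum_eq (f : Cx -> Cx) (L : list (R * Cx)) :
  clsum f L = mkC (lsum (fun w => Cre (f w)) L) (lsum (fun w => Cim (f w)) L).
Proof.
induction L as [|[l w] L IH]; [reflexivity|]; simpl; rewrite IH; cx_ring.
Qed.

Lemma clsum_add (f g : Cx -> Cx) (L : list (R * Cx)) :
  clsum (fun w => f w + g w)%cx L = (clsum f L + clsum g L)%cx.
Proof. induction L as [|[l w] L IH]; simpl; [|rewrite IH]; ring. Qed.

Lemma clsum_mul (a : Cx) (f : Cx -> Cx) (L : list (R * Cx)) :
  clsum (fun w => a * f w)%cx L = (a * clsum f L)%cx.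
Proof. induction L as [|[l w] L IH]; simpl; [|rewrite IH]; ring. Qed.

Lemma clsum_conj (f : Cx -> Cx) (L : list (R * Cx)) :
  ((clsum f L)^*)%cx = clsum (fun w => (f w)^*)%cx L.
Proof.
induction L as [|[l w] L IH]; simpl; [apply Cconj_0|].
rewrite Cconj_add, Cconj_mul, Cconj_RtoC, IH; auto.
Qed.

Lemma clsum_ext (f g : Cx -> Cx) (L : list (R * Cx)) :
  Forall (fun p => 0 < fst p /\ onT (snd p)) L -> (forall w, onT w -> f w = g w) ->
  clsum f L = clsum g L.
Proof.
intros HL E; induction HL as [|[l w] L [_ Hw] _ IH]; simpl; auto.
rewrite IH, E; auto.
Qed.

Lemma h_theta_clsum (th : list (R * Cx)) (z : Cx) :
  h_theta th z = clsum (fun w => herglotz_kernel w z) th.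
Proof. induction th as [|[l w] th IH]; simpl; auto; rewrite IH; auto. Qed.

Lemma psd_clsum (p : Cx -> Cx -> Cx) (L : list (R * Cx)) :
  Forall (fun p => 0 < fst p /\ onT (snd p)) L ->
  psd_kernel (fun x y => clsum (fun w => p w x * (p w y)^*)%cx L).
Proof.
intros HL; induction HL as [|[l w] L [Hl Hw] _ IH].
- apply (psd_ext (fun _ _ => C0 * C0^*)%cx); [intros; simpl; ring|apply psd_rank1].
- apply psd_add; auto; apply psd_scal; [simpl in Hl; lra|apply psd_rank1].
Qed.

(* With [v w] as below, [(1 - psi psi^* ) * szego = sum of l v v^*] and [x = sum of l w^2 v w x]; since
   the weights [l] have sum 1, subtracting [x y^*] leaves the "variance" [sum of l (v - w^*^2 x)(v - w^*^2 y)^*]. *)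
Lemma psi_theta_defect_hardy1 (th : list (R * Cx)) (x y : Cx) : Theta_hat th -> inD x -> inD y ->
  let v := fun w z => (RtoC 2 / ((w - z) * (h_theta th z + 1)))%cx in
  ((1 - psi_theta th x * (psi_theta th y)^*) * hardy1_kernel x y)%cx =
  (clsum (fun w => (v w x - (w * w)^* * x) * (v w y - (w * w)^* * y)^*) th
   + (x * psi_theta th x) * (y * psi_theta th y)^*)%cx.
Proof.
intros Hth Hx Hy v; destruct (Theta_hat_probability th Hth) as [Hpos [S1 [Sre Sim]]].
assert (S1' : clsum (fun _ => C1) th = C1) by (rewrite clsum_eq; simpl; rewrite S1; apply Cx_eq; simpl; auto;
  clear; induction th as [|[l w] L IH]; simpl; [auto|rewrite IH; ring]).
assert (Sw : clsum (fun w => w) th = C0) by (rewrite clsum_eq; apply Cx_eq; [exact Sre|exact Sim]).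
assert (N := fun z Hz => h_theta_add1_neq0 th Hpos z Hz).
(* On each atom, 2w^2 / (w - z) is 2w plus z times the Herglotz kernel plus 1. Summation kills 2w by
   the vanishing moment and leaves z times h + 1, as the mass is 1. *)
assert (Rep : forall z, inD z -> clsum (fun w => w * w * v w z)%cx th = z).
{ intros z Hz; specialize (N z Hz).
  rewrite (clsum_ext _ (fun w => (RtoC 2 / (h_theta th z + 1)) * w
    + (z / (h_theta th z + 1)) * (herglotz_kernel w z + 1))%cx); auto.
  - rewrite clsum_add, !clsum_mul, clsum_add, <- h_theta_clsum, S1', Sw; field; auto.
  - intros w Hw; generalize (onT_sub_neq0 _ _ Hw Hz); intros Nw.
    unfold v, herglotz_kernel; replace (RtoC 2) with (C1 + C1)%cx by cx_ring; field; auto. }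
(* For w on the circle, the Herglotz kernel at x plus its conjugate at y is 2 (1 - x y^* ) over (w -
   x) times the conjugate of (w - y); the Szego kernel cancels the numerator. *)
assert (Gram : clsum (fun w => v w x * (v w y)^*)%cx th =
  ((1 - psi_theta th x * (psi_theta th y)^*) * szego x y)%cx).
{ rewrite (psi_theta_defect th Hpos x y Hx Hy), !h_theta_clsum, clsum_conj, <- clsum_add, <- !h_theta_clsum.
  set (d := ((h_theta th x + 1) * (h_theta th y + 1)^*)%cx).
  assert (Nd : d <> C0).
  { apply Cneq0_of_norm; unfold d; rewrite Cnorm_mul.
    apply Rmult_lt_0_compat; apply Cnorm_gt0; [|apply Cconj_neq0]; auto. }
  replace (RtoC 2 * clsum (fun w => herglotz_kernel w x + (herglotz_kernel w y)^*) th / d * szego x y)%cx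
    with (RtoC 2 * szego x y / d * clsum (fun w => herglotz_kernel w x + (herglotz_kernel w y)^*) th)%cx
    by (field; auto).
  rewrite <- clsum_mul; apply clsum_ext; auto; intros w Hw.
  generalize (onT_sub_neq0 _ _ Hw Hx) (onT_sub_neq0 _ _ Hw Hy) (szego_denom_neq0 x y Hx Hy) (onT_neq0 _ Hw)
    (N x Hx) (N y Hy).
  intros A1 A2 A3 A4 A5 A6; apply Cconj_neq0 in A2, A6.
  unfold v, herglotz_kernel, szego, d; autorewrite with cconj in *.
  rewrite (onT_conj_inv w Hw) in *.
  assert (A7 : (1 - y^* * w)%cx <> C0).
  { intros E7; apply A2; replace (Cinv w - y^*)%cx with (Cinv w * (1 - y^* * w))%cx by (field; auto).
    rewrite E7; ring. }
  replace (RtoC 2) with (C1 + C1)%cx by cx_ring; field; repeat split; auto. }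
(* Each cross term sums to -x y^* by [Rep], and the square to +x y^*. The product on the left also
   subtracts x y^* but adds x psi times the conjugate of y psi, which is the rank one term. *)
rewrite (clsum_ext _ (fun w => v w x * (v w y)^* + (- y^* * (w * w * v w x))
   + (- x * (w * w * v w y)^* + (x * y^*) * 1))%cx); auto.
- rewrite !clsum_add, !clsum_mul, S1', Gram, <- clsum_conj, !Rep by auto.
  unfold hardy1_kernel; rewrite Cconj_mul; ring.
- intros w Hw; autorewrite with cconj.
  replace (x * y^* * 1)%cx with (x * y^* * (w * w^*) * (w * w^*))%cx
    by (rewrite onT_conj_mul by auto; ring).
  ring.
Qed.

Lemma hardy1_kernel_in_KPsi : in_KPsi Psi_hat hardy1_kernel.
Proof.
split; [apply psd_hardy1_kernel|].
intros psi [th [c [Hth [Hc ->]]]]; destruct (Theta_hat_probability th Hth) as [Hpos _].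
generalize (boundary_value_norm_le1 th Hpos c Hc) (Cnorm_ge0 c); intros Hc1 Hc0.
assert (P : psd_kernel (fun x y => (1 - psi_theta th x * (psi_theta th y)^*) * hardy1_kernel x y)%cx).
{ eapply psd_ext.
  - intros x y Hx Hy; symmetry; apply (psi_theta_defect_hardy1 th x y Hth Hx Hy).
  - apply psd_add; [|apply (psd_rank1 (fun x => x * psi_theta th x)%cx)].
    apply (psd_clsum (fun w z => RtoC 2 / ((w - z) * (h_theta th z + 1)) - (w * w)^* * z)%cx); auto. }
(* A modulus of [c] at most 1 suffices: 1 - |c|^2 psi psi^* is a convex combination of 1 - psi psi^*
   and 1. *)
apply (psd_ext (fun x y =>
  RtoC (Cnorm c * Cnorm c) * ((1 - psi_theta th x * (psi_theta th y)^*) * hardy1_kernel x y)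
  + RtoC (1 - Cnorm c * Cnorm c) * hardy1_kernel x y)%cx).
- intros x y _ _.
  replace (RtoC (1 - Cnorm c * Cnorm c)) with (1 - RtoC (Cnorm c * Cnorm c))%cx by cx_ring.
  rewrite <- Cnorm_sqr_conj; autorewrite with cconj; ring.
- apply psd_add; apply psd_scal; auto; [nra|nra|apply psd_hardy1_kernel].
Qed.

(** * Multipliers of all the kernels belong to [H^oo_1] *)

Lemma hardy1_kernel_diag (z : Cx) : inD z ->
  hardy1_kernel z z = RtoC (/ (1 - Cnorm2 z) - Cnorm2 z).
Proof.
intros Hz; apply inD_norm2 in Hz; unfold hardy1_kernel, szego.
rewrite Cnorm_sqr_conj, Cnorm_sqr; unfold Cinv.
set (N := Cnorm2 z) in *.
assert (E : Cnorm2 (1 - RtoC N) = (1 - N) * (1 - N)) by (unfold Cnorm2; cx_unfold; ring).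
rewrite E; apply Cx_eq; cx_unfold; field; lra.
Qed.

(* [<e_b, e_c>] for the divided differences [e_b = (k_b - k_a) / (b - a)^*] of the Szego kernel;
   its continuity in [(b, c)] at [(a, a)] is what makes [f] differentiable at [a]. *)
Definition divided_gram (a b c : Cx) : Cx :=
  ((1 - a * b * c^* * a^*)
   / ((1 - b * c^*) * (1 - a * c^*) * ((1 - b * a^*) * (1 - a * a^*))))%cx.

(** The subtracted 1 is the divided difference of the omitted term [x * y^*]. *)
Lemma divided_gram_eq (a b c : Cx) : inD a -> inD b -> inD c -> b <> a -> c <> a ->
  (1 / (b - a) * (1 / (c - a))^*
   * (hardy1_kernel b c - hardy1_kernel b a - hardy1_kernel a c + hardy1_kernel a a))%cx
  = (divided_gram a b c - 1)%cx.
Proof.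
intros Ha Hb Hc Nb Nc; apply Csub_neq0 in Nb, Nc; apply Cconj_neq0 in Nc.
generalize (szego_denom_neq0 b c Hb Hc) (szego_denom_neq0 b a Hb Ha)
  (szego_denom_neq0 a c Ha Hc) (szego_denom_neq0 a a Ha Ha); intros.
unfold divided_gram, hardy1_kernel, szego; autorewrite with cconj in *; field; repeat split; auto.
Qed.

Lemma divided_gram_continuous (a : Cx) : inD a -> forall eps, 0 < eps ->
  exists d, 0 < d /\ forall b c, Cnorm (b - a) < d -> Cnorm (c - a) < d ->
    Cnorm (divided_gram a b c - divided_gram a a a) < eps.
Proof.
intros Ha eps He.
set (F := filter_prod (near a) (near a)).
assert (Lb : clim F fst a).
{ intros e H; exists (fun w => Cnorm (w - a) < e) (fun _ => True).
  - apply (ccont_id a e H).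
  - apply filter_forall; auto.
  - auto. }
assert (Lc : clim F snd a).
{ intros e H; exists (fun _ => True) (fun w => Cnorm (w - a) < e).
  - apply filter_forall; auto.
  - apply (ccont_id a e H).
  - auto. }
assert (N := szego_denom_neq0 a a Ha Ha).
assert (L : clim F (fun p => divided_gram a (fst p) (snd p)) (divided_gram a a a)).
{ assert (N2 : forall u v, u <> C0 -> v <> C0 -> (u * v)%cx <> C0).
  { intros u v Hu Hv; apply Cneq0_of_norm; rewrite Cnorm_mul.
    apply Rmult_lt_0_compat; apply Cnorm_gt0; auto. }
  apply clim_div; [auto| |];
    repeat first [apply clim_sub | apply clim_mul | apply clim_conj]; auto; apply clim_const. }
destruct (L eps He) as [P Q HP HQ PQ].
destruct (filter_and _ _ HP HQ) as [d [Hd H]]; exists d; split; auto; intros b c Hb Hc.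
apply (PQ b c); apply H; auto.
Qed.

Definition punctured (a : Cx) (P : Cx -> Prop) : Prop := within (fun w => w <> a) (near a) P.

Global Instance punctured_filter (a : Cx) : ProperFilter (punctured a).
Proof.
constructor; [|apply within_filter, near_filter].
intros P [d [Hd H]]; exists (a + RtoC (d / 2))%cx.
assert (E : (a + RtoC (d / 2) - a)%cx = RtoC (d / 2)) by ring.
apply H; [rewrite E, Cnorm_RtoC, Rabs_pos_eq; lra|].
intros E2; rewrite E2 in E; apply (f_equal Cre) in E; cx_unfold; lra.
Qed.

Section Multiplier.
Variable f : Cx -> Cx.
Hypothesis Hf : in_ball_HinfK Psi_hat f.

(** The form at a single point, whose kernel value is positive: 1 / (1 - s) >= 1 > s for s in [0,
    1). *)
Lemma ball_norm_le1 (z : Cx) : inD z -> Cnorm (f z) <= 1.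
Proof.
intros Hz; destruct (Hf _ hardy1_kernel_in_KPsi 1%nat (fun _ => z) (fun _ => C1)) as [_ H]; auto.
revert H; cbn [csum].
rewrite (hardy1_kernel_diag z Hz), !Cnorm_sqr_conj, Cnorm1; apply inD_norm2 in Hz; intros H.
replace (Cre _) with ((1 - Cnorm (f z) * Cnorm (f z)) * (/ (1 - Cnorm2 z) - Cnorm2 z)) in H
  by (cx_unfold; ring).
generalize (Cnorm2_ge0 z) (Cnorm_ge0 (f z)); intros G1 G2.
assert (1 <= / (1 - Cnorm2 z)).
{ rewrite <- Rinv_1 at 1; apply Rinv_le_contravar; lra. }
apply Rnot_lt_le; intros G3.
assert (0 < Cnorm (f z) * Cnorm (f z) - 1) by nra.
assert (0 < / (1 - Cnorm2 z) - Cnorm2 z) by lra.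
nra.
Qed.

(** In Hilbert space terms, the constant 1 has norm at most 1 and [f] is a contractive multiplier,
    so [f] itself lies in the unit ball. On kernels: K - f f^* is (1 - f f^* ) K plus f f^* (K - 1),
    and K - 1 is a weighted Szego kernel. *)
Lemma ball_dominated (n : nat) (x c : nat -> Cx) : (forall i, (i < n)%nat -> inD (x i)) ->
  Cnorm2 (csum n (fun i => c i * f (x i))%cx) <= Cre (form n x c hardy1_kernel).
Proof.
intros Hx.
assert (P : psd_kernel (fun x y => hardy1_kernel x y + RtoC (-1) * (f x * (f y)^*))%cx).
{ apply (psd_ext (fun x y => (1 - f x * (f y)^*) * hardy1_kernel x y
    + (f x * (x * x)) * (f y * (y * y))^* * szego x y)%cx).
  - intros y z Hy Hz; rewrite hardy1_kernel_eq by auto; autorewrite with cconj.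
    replace (RtoC (-1)) with (- C1)%cx by cx_ring; ring.
  - apply psd_add; [apply (Hf _ hardy1_kernel_in_KPsi)|].
    apply (psd_weight (fun x => f x * (x * x))%cx), psd_szego. }
destruct (P n x c Hx) as [_ H]; fold (form n x c
  (fun x y => hardy1_kernel x y + RtoC (-1) * (f x * (f y)^*))%cx) in H.
rewrite form_add, form_scal, form_rank1, Cre_add, Cre_scal in H; simpl in H; lra.
Qed.

(** The kernel has no linear term, so the squared norm of its difference between [h] and 0 is only
    r^4 / (1 - r^2). *)
Lemma ball_cderiv_0 : has_cderiv_at f C0 C0.
Proof.
assert (D0 : inD C0) by (unfold inD; rewrite Cnorm0; lra).
(* For r < 1/2 the quantity r^4 / (1 - r^2) is at most 4 r^4, so the difference quotient is at most
   2r. *)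
intros eps He; exists (Rmin (1/2) (eps / 4)); split; [apply Rmin_pos; lra|].
intros h Hh Hd Hin; replace (C0 + h)%cx with h in * by ring.
generalize (Rmin_l (1/2) (eps / 4)) (Rmin_r (1/2) (eps / 4)); intros M1 M2.
assert (B := ball_dominated 2 (fun i => match i with O => h | _ => C0 end)
   (fun i => match i with O => C1 | _ => (- C1)%cx end)).
specialize (B ltac:(intros [|i] _; auto)).
unfold form in B; cbn [csum] in B.
replace (0 + 1 * f h + - (1) * f 0)%cx with (f h - f C0)%cx in B by ring.
assert (K1 : forall y, hardy1_kernel C0 y = C1).
{ intros y; unfold hardy1_kernel, szego; field; intros E; apply (f_equal Cre) in E; cx_unfold; lra. }
assert (K2 : forall y, hardy1_kernel y C0 = C1).
{ intros y; unfold hardy1_kernel, szego; rewrite Cconj_0; field.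
  intros E; apply (f_equal Cre) in E; cx_unfold; lra. }
rewrite (hardy1_kernel_diag h Hin), !K1, K2 in B.
set (r := Cnorm h) in *; assert (Hr : 0 < r) by (apply Cnorm_gt0; auto).
rewrite <- Cnorm_sqr in B; rewrite <- (Cnorm_sqr h) in B; fold r in B.
replace (Cre _) with (/ (1 - r * r) - r * r - 1) in B by (cx_unfold; ring).
replace (/ (1 - r * r) - r * r - 1) with (r * r * (r * r) / (1 - r * r)) in B by (field; nra).
assert (B2 : r * r * (r * r) / (1 - r * r) <= (2 * (r * r)) * (2 * (r * r))).
{ apply Rmult_le_reg_r with (1 - r * r); [nra|].
  unfold Rdiv; rewrite Rmult_assoc, Rinv_l by nra.
  assert (0 <= (r * r) * (r * r) * (3 - 4 * (r * r))) by (repeat apply Rmult_le_pos; nra); lra. }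
assert (B3 : Cnorm (f h - f C0) <= 2 * (r * r)).
{ apply Cnorm_le_of_sqr; [nra|]; rewrite <- Cnorm_sqr; lra. }
replace ((f h - f C0) / h - 0)%cx with ((f h - f C0) / h)%cx by (field; auto).
rewrite Cnorm_div by auto; fold r.
apply Rmult_lt_reg_r with r; auto.
unfold Rdiv; rewrite Rmult_assoc, Rinv_l by lra; nra.
Qed.

(** [ball_dominated] at three points, with coefficients producing a difference of two difference
    quotients; the constants 1 of [divided_gram_eq] cancel. *)
Lemma ball_divided_difference (a b c : Cx) : inD a -> inD b -> inD c -> b <> a -> c <> a ->
  Cnorm2 ((f b - f a) / (b - a) - (f c - f a) / (c - a)) <=
  Cre (divided_gram a b b - divided_gram a b c - divided_gram a c b + divided_gram a c c).
Proof.
intros Ha Hb Hc Nb Nc.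
set (p := (1 / (b - a))%cx); set (q := (1 / (c - a))%cx).
assert (B := ball_dominated 3 (fun i => match i with O => a | S O => b | _ => c end)
   (fun i => match i with O => (q - p)%cx | S O => p | _ => (- q)%cx end)).
specialize (B ltac:(intros [|[|i]] _; auto)).
replace (divided_gram a b b - divided_gram a b c - divided_gram a c b + divided_gram a c c)%cx
  with ((divided_gram a b b - 1) - (divided_gram a b c - 1) - (divided_gram a c b - 1)
        + (divided_gram a c c - 1))%cx by ring.
rewrite <- !divided_gram_eq by auto; fold p q.
unfold form in B; cbn [csum] in B.
replace ((f b - f a) / (b - a) - (f c - f a) / (c - a))%cx
  with (0 + (q - p) * f a + p * f b + - q * f c)%cx
  by (unfold p, q; field; split; apply Csub_neq0; auto).
eapply Rle_trans; [exact B|]; right; apply (f_equal Cre); autorewrite with cconj; ring.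
Qed.

(** The right side of [ball_divided_difference] is a second difference of a function continuous at
    [(a, a)], hence small: the difference quotients are Cauchy, and completeness of the reals
    supplies the derivative. *)
Lemma ball_holomorphic : holomorphic_on_D f.
Proof.
intros a Ha.
set (q := fun w => ((f w - f a) / (w - a))%cx).
assert (Cau : forall eps : posreal, exists P, punctured a P /\
  forall u v, P u -> P v -> Cnorm (q u - q v) < eps).
{ intros [eps He]; simpl.
  set (e := eps * eps / 8); assert (He' : 0 < e) by (unfold e; nra).
  destruct (divided_gram_continuous a Ha e He') as [d [Hd G]].
  exists (fun w => w <> a /\ inD w /\ Cnorm (w - a) < d); split.
  { destruct (near_inD a Ha) as [d' [Hd' I]].
    exists (Rmin d d'); split; [apply Rmin_pos; auto|]; intros w Hw Nw.
    generalize (Rmin_l d d') (Rmin_r d d'); intros; repeat split; [auto|apply I|]; lra. }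
  intros b c [Nb [Db Hb]] [Nc [Dc Hc]].
  assert (B := ball_divided_difference a b c Ha Db Dc Nb Nc); fold (q b) (q c) in B.
  assert (R4 : Cnorm2 (q b - q c) < 4 * e).
  { eapply Rle_lt_trans; [exact B|].
    replace (divided_gram a b b - divided_gram a b c - divided_gram a c b + divided_gram a c c)%cx
      with ((divided_gram a b b - divided_gram a a a) - (divided_gram a b c - divided_gram a a a)
        - ((divided_gram a c b - divided_gram a a a) - (divided_gram a c c - divided_gram a a a)))%cx by ring.
    eapply Rle_lt_trans; [apply Rle_abs|]; eapply Rle_lt_trans; [apply Cre_le_norm|].
    eapply Rle_lt_trans; [apply Cnorm_sub_triangle|].
    replace (4 * e) with ((e + e) + (e + e)) by ring.
    apply Rplus_lt_compat; (eapply Rle_lt_trans; [apply Cnorm_sub_triangle|]);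
      apply Rplus_lt_compat; apply G; auto. }
  rewrite <- Cnorm_sqr in R4; unfold e in R4; generalize (Cnorm_ge0 (q b - q c)); nra. }
assert (Re : exists l, filterlim (fun w => Cre (q w)) (punctured a) (locally l)).
{ apply (proj1 (filterlim_locally_cauchy (fun w => Cre (q w)))); intros eps.
  destruct (Cau eps) as [P [HP H]]; exists P; split; auto; intros u v Hu Hv.
  eapply Rle_lt_trans; [apply (Cre_le_norm (q v - q u))|apply H; auto]. }
assert (Im : exists l, filterlim (fun w => Cim (q w)) (punctured a) (locally l)).
{ apply (proj1 (filterlim_locally_cauchy (fun w => Cim (q w)))); intros eps.
  destruct (Cau eps) as [P [HP H]]; exists P; split; auto; intros u v Hu Hv.
  eapply Rle_lt_trans; [apply (Cim_le_norm (q v - q u))|apply H; auto]. }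
destruct Re as [l1 L1], Im as [l2 L2]; exists (mkC l1 l2).
assert (L : clim (punctured a) q (mkC l1 l2)) by (apply clim_re_im; auto).
intros eps He; destruct (L eps He) as [d [Hd H]]; exists d; split; auto.
intros h Hh Hhd _.
assert (E : (a + h - a)%cx = h) by ring.
generalize (H (a + h)%cx); unfold q; rewrite E; intros H'; apply H'; auto.
intros E2; apply Hh; rewrite <- E, E2; ring.
Qed.

Lemma ball_in_Hinf1 : in_Hinf1 f.
Proof.
split; [apply ball_holomorphic|split; [|apply ball_cderiv_0]].
exists 1; apply ball_norm_le1.
Qed.

End Multiplier.

Lemma Cnorm_div_pos (t : R) (z : Cx) : 0 < t -> Cnorm (RtoC (/ t) * z) = Cnorm z / t.
Proof.
intros Ht; rewrite Cnorm_mul, Cnorm_RtoC, Rabs_pos_eq; [unfold Rdiv; ring|].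
left; apply Rinv_0_lt_compat; auto.
Qed.

Lemma has_cderiv_at_scal (f : Cx -> Cx) (a z l : Cx) : inD z ->
  has_cderiv_at f z l -> has_cderiv_at (fun w => a * f w)%cx z (a * l).
Proof.
intros Hz H; apply has_cderiv_at_cdiff in H; auto; apply cdiff_has_cderiv_at.
replace (a * l)%cx with (C0 * f z + a * l)%cx by ring.
apply cdiff_mul; [apply cdiff_const|auto].
Qed.

Lemma Hinf1_scal (f : Cx -> Cx) (a : Cx) : in_Hinf1 f -> in_Hinf1 (fun w => a * f w)%cx.
Proof.
assert (D0 : inD C0) by (unfold inD; rewrite Cnorm0; lra).
intros [Hf [[M HM] H0]]; split; [|split].
- intros z Hz; destruct (Hf z Hz) as [l Hl]; eexists; apply has_cderiv_at_scal; eauto.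
- exists (Cnorm a * M); intros z Hz; rewrite Cnorm_mul.
  apply Rmult_le_compat_l; [apply Cnorm_ge0|auto].
- replace C0 with (a * C0)%cx at 2 by ring; apply has_cderiv_at_scal; auto.
Qed.

Lemma Hinf1_scaled_in_ball (f : Cx -> Cx) (M t : R) : in_Hinf1 f -> 0 <= M < t ->
  (forall z, inD z -> Cnorm (f z) <= M) ->
  in_ball_HinfK Psi_hat (fun z => RtoC (/ t) * f z)%cx.
Proof.
intros Hf Ht HM; destruct (Hinf1_scal f (RtoC (/ t)) Hf) as [H1 [_ H2]].
apply contraction_in_ball with (M / t); auto.
- apply Rmult_lt_reg_r with t; [lra|]; unfold Rdiv; rewrite Rmult_assoc, Rinv_l by lra; lra.
- intros z Hz; rewrite Cnorm_div_pos by lra; apply Rmult_le_compat_r; auto.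
  left; apply Rinv_0_lt_compat; lra.
Qed.

Theorem mainTheorem7 :
  (forall f : Cx -> Cx, in_HinfK Psi_hat f <-> in_Hinf1 f) /\
  (forall f : Cx -> Cx, in_Hinf1 f ->
     forall N : R, is_lub (abs_values_on_D f) N ->
       is_glb (norm_set_HinfK Psi_hat f) N).
Proof.
assert (D0 : inD C0) by (unfold inD; rewrite Cnorm0; lra).
split.
- intros f; split.
  + intros [c [g [Hg E]]].
    destruct (Hinf1_scal g c (ball_in_Hinf1 g Hg)) as [H1 [[M HM] H2]].
    split; [|split].
    * intros z Hz; destruct (H1 z Hz) as [l Hl]; exists l; revert Hl.
      apply has_cderiv_at_ext; auto; intros; symmetry; auto.
    * exists M; intros z Hz; rewrite E; auto.
    * revert H2; apply has_cderiv_at_ext; auto; intros; symmetry; auto.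
  + intros Hf; destruct Hf as [H1 [[M HM] H2]].
    assert (M0 : 0 <= M) by (generalize (HM _ D0) (Cnorm_ge0 (f C0)); lra).
    (* [M + 1] is positive even when [M] is 0, and it makes the bound on the scaled function
       strict. *)
    exists (RtoC (M + 1)), (fun z => RtoC (/ (M + 1)) * f z)%cx; split.
    * apply Hinf1_scaled_in_ball with M; [split; eauto|lra|auto].
      split; eauto; exists M; auto.
    * intros z _; replace (RtoC (M + 1) * (RtoC (/ (M + 1)) * f z))%cx
        with (RtoC ((M + 1) * / (M + 1)) * f z)%cx by (rewrite RtoC_mul; ring).
      rewrite Rinv_r by lra; fold C1; ring.
- intros f Hf N [HN1 HN2].
  assert (HN : forall z, inD z -> Cnorm (f z) <= N) by (intros z Hz; apply HN1; exists z; auto).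
  assert (N0 : 0 <= N) by (generalize (HN _ D0) (Cnorm_ge0 (f C0)); lra).
  split.
  + intros t [Ht Hb]; apply HN2; intros r [z [Hz ->]].
    generalize (ball_norm_le1 _ Hb z Hz); rewrite Cnorm_div_pos by auto; intros H.
    apply Rmult_le_compat_r with (r := t) in H; [|lra].
    unfold Rdiv in H; rewrite Rmult_assoc, Rinv_l in H by lra; lra.
  + intros b Hb; apply Rnot_lt_le; intros H.
    (* If b exceeded N, the midpoint would be an admissible scaling factor above N and below the
       lower bound b. *)
    assert (b <= (N + b) / 2); [|lra].
    apply Hb; split; [lra|]; apply Hinf1_scaled_in_ball with N; auto; lra.
Qed.
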